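(* Let $X(K,U)$ be an Oeljeklaus-Toma manifold of type $(s,t)$. Then $X(K,U)$ admits a pluriclosed metric if and only if $s=t$ and, after possibly relabeling the embeddings, for every $u\in U$, $$\sigma_j(u)\,|\sigma_{s+j}(u)|^2=1\quad\text{for all } j\in\{1,\dots,s\}.$$
   Context: Oeljeklaus-Toma manifolds: let $s,t\ge 1$ be integers and $K$ a number field with exactly $s$ real embeddings $\sigma_1,\dots,\sigma_s$ and $2t$ non-real complex embeddings $\sigma_{s+1},\dots,\sigma_{s+2t}$, labelled so that $\sigma_{s+t+j}=\overline{\sigma_{s+j}}$ for $1\le j\le t$ (relabelings are understood to preserve this convention). Let $\mathcal O_K$ be the ring of integers and $\mathcal O_K^{*,+}$ the group of totally positive units (units $u$ with $\sigma_j(u)>0$ for $1\le j\le s$). Let $\mathbb H\subset\mathbb C$ be the upper half-plane. On $\mathbb H^s\times\mathbb C^t$, $a\in\mathcal O_K$ acts by translation by $(\sigma_1(a),\dots,\sigma_{s+t}(a))$ and $u\in\mathcal O_K^{*,+}$ acts by multiplying the $j$-th coordinate by $\sigma_j(u)$. A subgroup $U\subset\mathcal O_K^{*,+}$ of rank $s$ is admissible if the resulting fixed-point-free action of $\mathcal O_K\rtimes U$ on $\mathbb H^s\times\mathbb C^t$ is properly discontinuous and co-compact (by construction $\{(\log\sigma_1(u),\dots,\log\sigma_s(u)):u\in U\}$ is a lattice of rank $s$ in $\mathbb R^s$). For admissible $U$, the Oeljeklaus-Toma manifold of type $(s,t)$ is the compact complex manifold $X(K,U)=(\mathbb H^s\times\mathbb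 C^t)/(\mathcal O_K\rtimes U)$, of complex dimension $n=s+t$. A pluriclosed (SKT) metric is a Hermitian metric whose associated $(1,1)$-form $\omega$ satisfies $\partial\overline\partial\omega=0$. *)

(* Defs.v *)
From HB Require Import structures.
From mathcomp Require Import all_boot all_order all_algebra all_field complex.
From mathcomp Require Import all_classical all_reals all_analysis.

Set Implicit Arguments.
Unset Strict Implicit.
Unset Printing Implicit Defensive.

Import Order.TTheory GRing.Theory Num.Theory numFieldNormedType.Exports.

Local Open Scope classical_set_scope.
Local Open Scope ring_scope.

(* The complex numbers R[i], seen as a numClosedFieldType so that C and 'rV[C]_n
   carry the topology and the normed C-module structure of MathComp-Analysis.
   The order on this type is partial: 0 < z means that z is real and positive. *)
Definition Cx (R : realType) : numClosedFieldType := R[i].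

(** * Smooth complex-valued functions on open subsets of C^n *)

(* f o (t |-> z + t v), with t a *real* variable. *)
Definition along (R : realType) (n : nat) (f : 'rV[Cx R]_n -> Cx R)
    (z v : 'rV[Cx R]_n) (t : R) : Cx R :=
  f (z + (t%:C)%C *: v).

Definition rderivable (R : realType) (n : nat) (f : 'rV[Cx R]_n -> Cx R)
    (z v : 'rV[Cx R]_n) : Prop :=
  derivable (fun t : R => complex.Re (along f z v t) : R) 0 1 /\
  derivable (fun t : R => complex.Im (along f z v t) : R) 0 1.

Definition rderive (R : realType) (n : nat) (v : 'rV[Cx R]_n)
    (f : 'rV[Cx R]_n -> Cx R) (z : 'rV[Cx R]_n) : Cx R :=
  Complex (derive1 (fun t : R => complex.Re (along f z v t) : R) 0)
          (derive1 (fun t : R => complex.Im (along f z v t) : R) 0).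

(* Class C^m in the sense of real differentiability; v ranges over C^n = R^2n. *)
Fixpoint Ck (R : realType) (n m : nat) (V : set 'rV[Cx R]_n)
    (f : 'rV[Cx R]_n -> Cx R) : Prop :=
  (forall z, V z -> {for z, continuous f}) /\
  if m is m'.+1 then
    forall v : 'rV[Cx R]_n,
      (forall z, V z -> rderivable f z v) /\ Ck m' V (rderive v f)
  else True.

Definition smooth_on (R : realType) (n : nat) (V : set 'rV[Cx R]_n)
    (f : 'rV[Cx R]_n -> Cx R) : Prop := forall m, Ck m V f.

(** * The operators d and dbar on (p,q)-forms *)

(* d/dz_j = (d/dx_j - i d/dy_j)/2 and d/dzbar_j = (d/dx_j + i d/dy_j)/2 *)
Definition wirtinger (R : realType) (n : nat) (j : 'I_n)
    (f : 'rV[Cx R]_n -> Cx R) (z : 'rV[Cx R]_n) : Cx R :=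
  (rderive (delta_mx 0 j) f z - 'i * rderive ('i *: delta_mx 0 j) f z) / 2.

Definition wirtinger_bar (R : realType) (n : nat) (j : 'I_n)
    (f : 'rV[Cx R]_n -> Cx R) (z : 'rV[Cx R]_n) : Cx R :=
  (rderive (delta_mx 0 j) f z + 'i * rderive ('i *: delta_mx 0 j) f z) / 2.

(* A (p,q)-form alpha is given by its coefficients alpha_{J,K}, alternating in
   J and in K:
     alpha = 1/(p! q!) sum_{J,K} alpha_{J,K}
             dz_{J 0} /\ .. /\ dz_{J (p-1)} /\ dzbar_{K 0} /\ .. /\ dzbar_{K (q-1)} *)
Definition form (R : realType) (n p q : nat) : Type :=
  ('I_p -> 'I_n) -> ('I_q -> 'I_n) -> 'rV[Cx R]_n -> Cx R.

Definition del (R : realType) (n p q : nat) (alpha : form R n p q) :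
    form R n p.+1 q :=
  fun J K z => \sum_(i < p.+1)
    (-1) ^+ i * wirtinger (J i) (alpha (J \o lift i) K) z.

(* The sign (-1)^p moves the new factor dzbar past the p factors dz. *)
Definition delbar (R : realType) (n p q : nat) (alpha : form R n p q) :
    form R n p q.+1 :=
  fun J K z => (-1) ^+ p * \sum_(i < q.+1)
    (-1) ^+ i * wirtinger_bar (K i) (alpha J (K \o lift i)) z.

(** * Hermitian and pluriclosed metrics on a complex manifold *)

(* A complex manifold of dimension n is presented by its holomorphic
   parametrizations (V, p): V is open in C^n and p maps V bijectively onto an open
   subset of the manifold, i.e. the restriction of p to V is an inverse chart. *)
Definition parametrization (R : realType) (n : nat) (X : Type) : Type :=
  (set 'rV[Cx R]_n * ('rV[Cx R]_n -> X))%type.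

Definition atlas (R : realType) (n : nat) (X : Type) : Type :=
  set (parametrization R n X).

(* phi represents, near z, the change of coordinates from c to c'. *)
Definition is_transition (R : realType) (n : nat) (X : Type)
    (c c' : parametrization R n X) (phi : 'rV[Cx R]_n -> 'rV[Cx R]_n)
    (z : 'rV[Cx R]_n) : Prop :=
  c.1 z /\ \forall w \near z, c'.1 (phi w) /\ c'.2 (phi w) = c.2 w.

Definition conjtr (R : realType) (m n : nat) (A : 'M[Cx R]_(m, n)) :
    'M[Cx R]_(n, m) := map_mx Num.conj A^T.

Definition hermitian_posdef (R : realType) (n : nat) (A : 'M[Cx R]_n) : Prop :=
  A = conjtr A /\
  forall v : 'rV[Cx R]_n, v != 0 -> 0 < (v *m A *m conjtr v) 0 0.

(* h c z is the Gram matrix (h(d/dz_j, d/dz_k))_{j,k} of the metric in the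
   coordinates c.  With the row-vector convention of [jacobian] the entry (j, k) of
   jacobian phi z is the holomorphic derivative of phi_k along z_j. *)
Definition hermitian_metric (R : realType) (n : nat) (X : Type)
    (A : atlas R n X)
    (h : parametrization R n X -> 'rV[Cx R]_n -> 'M[Cx R]_n) : Prop :=
  [/\ forall c, A c -> forall j k, smooth_on c.1 (fun z => h c z j k),
      forall c z, A c -> c.1 z -> hermitian_posdef (h c z) &
      forall c c' phi z, A c -> A c' -> is_transition c c' phi z ->
        h c z = jacobian phi z *m h c' (phi z) *m conjtr (jacobian phi z)].

(* omega = i sum_{j,k} h_{jk} dz_j /\ dzbar_k *)
Definition fundamental_form (R : realType) (n : nat)
    (H : 'rV[Cx R]_n -> 'M[Cx R]_n) : form R n 1 1 :=
  fun J K z => 'i * H z (J ord0) (K ord0).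

Definition pluriclosed (R : realType) (n : nat) (X : Type) (A : atlas R n X)
    (h : parametrization R n X -> 'rV[Cx R]_n -> 'M[Cx R]_n) : Prop :=
  forall c, A c -> forall J K z, c.1 z ->
    del (delbar (fundamental_form (h c))) J K z = 0.

Definition admits_pluriclosed_metric (R : realType) (n : nat) (X : Type)
    (A : atlas R n X) : Prop :=
  exists h, hermitian_metric A h /\ pluriclosed A h.

(** * Number fields *)

(* The index set {1, .., s + 2t} is 'I_(s + t + t) (shifted by one). *)
Definition real_idx (s t : nat) (j : 'I_s) : 'I_(s + t + t) :=
  lshift t (lshift t j).
Definition cplx_idx (s t : nat) (j : 'I_t) : 'I_(s + t + t) :=
  lshift t (rshift s j).
Definition conj_idx (s t : nat) (j : 'I_t) : 'I_(s + t + t) :=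
  rshift (s + t) j.

(* sigma lists all the complex embeddings of K, each one exactly once: first the s
   real ones, then t non-real ones, then their conjugates in the same order. *)
Definition embedding_labelling (R : realType) (s t : nat) (K : fieldExtType rat)
    (sigma : 'I_(s + t + t) -> {rmorphism K -> Cx R}) : Prop :=
  [/\ (forall i j, sigma i =1 sigma j -> i = j),
      (forall f : {rmorphism K -> Cx R}, exists i, f =1 sigma i),
      (forall (j : 'I_s) x, sigma (real_idx t j) x \is Num.real),
      (forall j : 'I_t,
         ~ (forall x, sigma (cplx_idx s j) x \is Num.real)) &
      (forall (j : 'I_t) x,
         sigma (conj_idx s j) x = (sigma (cplx_idx s j) x)^*)].

Definition ring_of_integers (K : fieldExtType rat) : set K :=
  [set a | integralOver (fun m : int => m%:~R : K) a].

Definition totally_positive_units (R : realType) (s t : nat)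
    (K : fieldExtType rat) (sigma : 'I_(s + t + t) -> {rmorphism K -> Cx R}) :
    set K :=
  [set u | [/\ u != 0, ring_of_integers u, ring_of_integers u^-1 &
              forall j : 'I_s, 0 < sigma (real_idx t j) u]].

Definition mul_subgroup (K : fieldExtType rat) (U : set K) : Prop :=
  [/\ U 1, (forall u v, U u -> U v -> U (u * v)) & (forall u, U u -> U u^-1)].

Definition mul_independent (K : fieldExtType rat) (m : nat) (v : 'I_m -> K) :
    Prop :=
  forall e : 'I_m -> int, \prod_(i < m) (v i) ^ (e i) = 1 -> forall i, e i = 0.

(* The dimension of the Q-vector space U (x) Q. *)
Definition has_rank (K : fieldExtType rat) (U : set K) (r : nat) : Prop :=
  (exists v : 'I_r -> K, (forall i, U (v i)) /\ mul_independent v) /\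
  (forall (m : nat) (v : 'I_m -> K),
     (forall i, U (v i)) -> mul_independent v -> (m <= r)%N).

(** * Oeljeklaus-Toma manifolds *)

(* H^s x C^t, as an open subset of C^(s+t) *)
Definition OT_domain (R : realType) (s t : nat) : set 'rV[Cx R]_(s + t) :=
  [set z | forall j : 'I_s, 0 < complex.Im (z 0 (lshift t j))].

Definition OT_act (R : realType) (s t : nat) (K : fieldExtType rat)
    (sigma : 'I_(s + t + t) -> {rmorphism K -> Cx R}) (g : K * K)
    (z : 'rV[Cx R]_(s + t)) : 'rV[Cx R]_(s + t) :=
  \row_j (sigma (lshift t j) g.2 * z 0 j + sigma (lshift t j) g.1).

(* O_K x| U, the pair (a, u) standing for z |-> u z + a *)
Definition OT_group (K : fieldExtType rat) (U : set K) : set (K * K) :=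
  [set g | ring_of_integers g.1 /\ U g.2].

Definition properly_discontinuous (R : realType) (s t : nat)
    (K : fieldExtType rat) (sigma : 'I_(s + t + t) -> {rmorphism K -> Cx R})
    (U : set K) : Prop :=
  forall B : set 'rV[Cx R]_(s + t), compact B -> B `<=` @OT_domain R s t ->
    finite_set [set g | OT_group U g /\ exists z, B z /\ B (OT_act sigma g z)].

Definition cocompact (R : realType) (s t : nat)
    (K : fieldExtType rat) (sigma : 'I_(s + t + t) -> {rmorphism K -> Cx R})
    (U : set K) : Prop :=
  exists B : set 'rV[Cx R]_(s + t), [/\ compact B, B `<=` @OT_domain R s t &
    forall z, OT_domain z -> exists2 g, OT_group U g & B (OT_act sigma g z)].

(* Freeness of the action is automatic: a fixed point of (a, u) forces
   sigma_j(u) = 1 for j <= s, whence u = 1 and a = 0. *)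
Definition admissible (R : realType) (s t : nat)
    (K : fieldExtType rat) (sigma : 'I_(s + t + t) -> {rmorphism K -> Cx R})
    (U : set K) : Prop :=
  [/\ mul_subgroup U, U `<=` totally_positive_units sigma, has_rank U s,
      properly_discontinuous sigma U & cocompact sigma U].

Definition OT_orbit (R : realType) (s t : nat) (K : fieldExtType rat)
    (sigma : 'I_(s + t + t) -> {rmorphism K -> Cx R}) (U : set K)
    (z : 'rV[Cx R]_(s + t)) : set 'rV[Cx R]_(s + t) :=
  [set OT_act sigma g z | g in OT_group U].

(* X(K, U): its points are the orbits of the action on H^s x C^t, and its complex
   structure is the quotient one, parametrized by the restrictions of the quotient
   map to the open sets on which it is injective. *)
Definition OT_manifold (R : realType) (s t : nat) (K : fieldExtType rat)
    (sigma : 'I_(s + t + t) -> {rmorphism K -> Cx R}) (U : set K) :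
    atlas R (s + t) (set 'rV[Cx R]_(s + t)) :=
  [set c | [/\ c.2 = OT_orbit sigma U, open c.1, c.1 `<=` @OT_domain R s t &
              forall z w, c.1 z -> c.1 w -> c.2 z = c.2 w -> z = w]].

(* Main.v *)
Require Import Defs.
From HB Require Import structures.
From mathcomp Require Import all_boot all_order all_algebra all_field complex.
From mathcomp Require Import all_classical all_reals all_analysis.
From mathcomp Require Import ring lra.
Import Order.TTheory GRing.Theory Num.Theory numFieldNormedType.Exports.
Import ComplexField.Normc.
Local Open Scope classical_set_scope.
Local Open Scope ring_scope.

(* A pluriclosed metric lifts to H^s x C^t, where it is O_K-invariant and equivariant
   under U.  Averaging its coefficients over the torus (R^s x C^t) / O_K kills the
   derivatives along the torus, so the dz_j dzbar_k dw_a dwbar_a component of the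
   equation says that the averaged coefficient of dw_a dwbar_a is a positive affine
   function of y = Im z.  Equivariance then forces either |sigma_a| = 1 on U or
   sigma_j |sigma_a|^2 = 1 on U for some j.  The first case is impossible since the
   conjugate of sigma_a(u) would be its inverse; in the second one, a unit has norm 1
   and U contains units with any prescribed pattern of sigma_j > 1 or sigma_j < 1, so
   a |-> j is a bijection.  Instead of integrating over the torus, we average over
   grids whose mesh tends to 0 while their size tends to infinity: such averages of a
   derivative are O(1/m), which only uses that functions periodic under O_K are
   bounded.  Conversely sum_j dz_j dzbar_j / y_j^2 + sum_a y_(j a) dw_a dwbar_a
   is invariant and pluriclosed. *)

Set Implicit Arguments.
Unset Strict Implicit.
Unset Printing Implicit Defensive.

(** * Complex coordinates *)

Section ComplexTopology.
Variable R : realType.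
Local Notation C := (Cx R).
Implicit Types (z w : C) (x y e : R).

(** For real indices j, k and a complex index A, the component used reads d_j dbar_k h_AA - d_j
    dbar_A h_Ak - d_A dbar_k h_jA + d_A dbar_A h_jk = 0. Every term but the first contains a
    derivative along the torus, and in the mean the first becomes a quarter of the second derivative
    in y_j and y_k; all pairs (j, k) occur, so the whole Hessian in y vanishes. The obstacle is that
    a finite average never satisfies this equation exactly. The Hessian is therefore replaced by a
    comparison of gradients at two points, with an error O(1/m) uniform for y in a compact range,
    and the limit is not identified with an integral: only two-sided bounds over the slices Im z = y
    pass to it. They suffice, since u carries the slice y = 1 onto y = (sigma_j(u))_j and scales the
    coefficient by |sigma_a(u)|^-2, while an affine function that is nonnegative on the positive
    orthant has nonnegative coefficients. Boundedness of periodic functions and the prescribed sign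
    patterns are both read off from admissibility, by pushing well-chosen points into a compact set
    that meets every orbit. *)

Lemma normCxE z : `|z| = ((normc z)%:C)%C :> C.
Proof. by []. Qed.

Lemma normc_ge0 z : 0 <= normc z.
Proof. by case: z => a b; rewrite /= sqrtr_ge0. Qed.

Lemma Re_le_normc z : `|complex.Re z| <= normc z.
Proof. by have := normc_ge_Re z; rewrite normCxE lecR. Qed.

Lemma Im_le_normc z : `|complex.Im z| <= normc z.
Proof.
case: z => a b /=; rewrite -[`|b|]sqrtr_sqr; apply: ler_wsqrtr.
by rewrite lerDr sqr_ge0.
Qed.

Lemma normc_le z : normc z <= `|complex.Re z| + `|complex.Im z|.
Proof.
case: z => a b /=; rewrite -[leRHS]ger0_norm ?addr_ge0 // -[leRHS]sqrtr_sqr.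
apply: ler_wsqrtr; rewrite sqrrD !real_normK ?num_real // addrAC.
by rewrite lerDl mulrn_wge0 // mulr_ge0.
Qed.

Lemma normc_real x : normc (x%:C)%C = `|x|.
Proof. by rewrite /= expr0n addr0 sqrtr_sqr. Qed.

Lemma Re_add z w : complex.Re (z + w) = complex.Re z + complex.Re w.
Proof. by case: z w => a b [c d]. Qed.
Lemma Im_add z w : complex.Im (z + w) = complex.Im z + complex.Im w.
Proof. by case: z w => a b [c d]. Qed.
Lemma Re_opp z : complex.Re (- z) = - complex.Re z.
Proof. by case: z => a b. Qed.
Lemma Im_opp z : complex.Im (- z) = - complex.Im z.
Proof. by case: z => a b. Qed.
Lemma Re_realM x z : complex.Re ((x%:C)%C * z) = x * complex.Re z.
Proof. by case: z => a b /=; rewrite mul0r subr0. Qed.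
Lemma Im_realM x z : complex.Im ((x%:C)%C * z) = x * complex.Im z.
Proof. by case: z => a b /=; rewrite mul0r addr0. Qed.

Lemma near_normc z e : 0 < e -> \forall w \near z, normc (z - w) < e.
Proof.
move=> e0; apply/nbhs_ballP; exists ((e%:C)%C : C); first by rewrite /= ltcR.
by move=> w /= zw; rewrite -ltcR -normCxE; exact: zw.
Qed.

Lemma continuous_Re : continuous (fun z : C => complex.Re z : R).
Proof.
move=> z; apply/(@cvgrPdist_lt _ _ _ (nbhs z) (nbhs_filter z)) => e e0.
apply: (@filterS _ (nbhs z) (nbhs_filter z) _ _ _ (near_normc z e0)) => w.
apply: le_lt_trans.
by rewrite -Re_opp -Re_add Re_le_normc.
Qed.

Lemma continuous_Im : continuous (fun z : C => complex.Im z : R).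
Proof.
move=> z; apply/(@cvgrPdist_lt _ _ _ (nbhs z) (nbhs_filter z)) => e e0.
apply: (@filterS _ (nbhs z) (nbhs_filter z) _ _ _ (near_normc z e0)) => w.
apply: le_lt_trans.
by rewrite -Im_opp -Im_add Im_le_normc.
Qed.

Lemma continuous_to_Cx (T : topologicalType) (f : T -> C) (p : T) :
  (fun q => complex.Re (f q) : R) @ p --> (complex.Re (f p) : R) ->
  (fun q => complex.Im (f q) : R) @ p --> (complex.Im (f p) : R) ->
  {for p, continuous f}.
Proof.
move=> fR fI; apply/cvgrPdist_lt => e e0.
(* Radii live in [Cx R] itself; a positive one is real, which reduces the estimate to real
   numbers. *)
have eE : e = ((complex.Re e)%:C)%C.
  by rewrite RRe_real // ger0_real // ltW.
rewrite eE ltcR in e0 *; set d := complex.Re e in e0 *.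
have d20 : 0 < d / 2 by rewrite divr_gt0.
have hR := cvgr_dist_lt _ _ fR _ d20; have hI := cvgr_dist_lt _ _ fI _ d20.
near=> q; rewrite normCxE ltcR.
apply: le_lt_trans (normc_le _) _.
rewrite !Re_add !Im_add !Re_opp !Im_opp.
rewrite (splitr d); apply: ltrD; near: q; [exact: hR|exact: hI].
Unshelve. all: by end_near. Qed.

Lemma compact_rect (a b c d : R) :
  compact [set z : C | (a <= complex.Re z <= b) /\ (c <= complex.Im z <= d)].
Proof.
have /= := @continuous_compact (R * R)%type C (fun p => Complex p.1 p.2)
  (`[a, b] `*` `[c, d]).
rewrite (_ : [set Complex p.1 p.2 | p in _] = [set z : C | (a <= complex.Re z
  <= b) /\ (c <= complex.Im z <= d)]); last first.
  apply/seteqP; split => [z [[x y] /= [+ +] <-]|z /= [h1 h2]].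
    by rewrite !in_itv.
  exists (complex.Re z, complex.Im z); last by case: (z).
  by split; rewrite /= in_itv.
apply; last by apply: compact_setX; apply: segment_compact.
apply/continuous_subspaceT => p; apply: continuous_to_Cx => /=;
  [exact: cvg_fst | exact: cvg_snd].
Qed.

End ComplexTopology.

(** * Continuity and compactness in C^n *)

Section RowTopology.
Variable R : realType.
Local Notation C := (Cx R).

Lemma continuous_rV (T : topologicalType) n (f : T -> 'rV[C]_n) (p : T) :
  (forall i, {for p, continuous (fun q => f q 0 i)}) -> {for p, continuous f}.
Proof.
move=> fc; apply/cvg_ballP => e e0.
have : \forall q \near p, forall i, ball (f p 0 i) e (f q 0 i).
  apply: filter_forall => i; move: (fc i) => /cvg_ballP; exact.
apply: filterS => q hq; split=> // i j; rewrite ord1; exact: hq.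
Qed.

Lemma compact_box n (B : R) (Y : 'I_n -> R * R) :
  compact [set z : 'rV[C]_n | forall i, `|complex.Re (z 0 i)| <= B /\
     ((Y i).1 <= complex.Im (z 0 i) <= (Y i).2)].
Proof.
have := @rV_compact C n (fun i => [set z : C | (- B <= complex.Re z <= B) /\ ((Y i).1
  <= complex.Im z <= (Y i).2)]).
rewrite (_ : [set v : 'rV_n | _] = [set z : 'rV[C]_n | forall i,
  `|complex.Re (z 0 i)| <= B /\
     ((Y i).1 <= complex.Im (z 0 i) <= (Y i).2)]); last first.
  by apply/seteqP; split => z /= h i; have := h i; rewrite /= ler_norml.
by apply => i; apply: compact_rect.
Qed.

Lemma compact_bounded n (B : set 'rV[C]_n) (f : 'rV[C]_n -> R) :
  compact B -> (forall z, B z -> {for z, continuous f}) ->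
  exists M, forall z, B z -> `|f z| <= M.
Proof.
move=> cB cf.
have : compact (f @` B).
  by apply: continuous_compact => //; apply: continuous_in_subspaceT => z /set_mem /cf.
move=> /compact_bounded [M [_ hM]]; exists (M + 1) => z Bz.
by apply: hM; [rewrite ltrDl|exists z].
Qed.

Lemma compact_lower n (B : set 'rV[C]_n) (f : 'rV[C]_n -> R) :
  compact B -> (forall z, B z -> {for z, continuous f}) ->
  (forall z, B z -> 0 < f z) ->
  exists2 d, 0 < d & forall z, B z -> d <= f z.
Proof.
move=> cB cf f0.
have [->|/set0P B0] := eqVneq B set0; first by exists 1.
have [z0 Bz0 h] : exists2 c, B c & forall t, B t -> f c <= f t.
  have [] := @compact_EVT_min _ _ f B B0 cB.
    by apply: continuous_in_subspaceT => z /set_mem /cf.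
  by move=> c /set_mem Bc h; exists c => // t Bt; apply: h; rewrite inE.
by exists (f z0); [exact: f0|].
Qed.

End RowTopology.

(** * Directional derivatives *)

Section RealDerivative.
Variable R : realType.
Local Notation C := (Cx R).
Variable n : nat.
Local Notation V := 'rV[C]_n.
Implicit Types (f g : V -> C) (z v w p : V) (t : R) (d : C).

Lemma continuous_line z v : continuous (fun t : R => z + (t%:C)%C *: v).
Proof.
move=> t; apply: continuous_rV => i; apply: continuous_to_Cx => /=.
  under eq_fun do rewrite !mxE Re_add Re_realM.
  rewrite !mxE Re_add Re_realM; apply: cvgD; first exact: cvg_cst.
  by apply: cvgMl; exact: cvg_id.
under eq_fun do rewrite !mxE Im_add Im_realM.
rewrite !mxE Im_add Im_realM; apply: cvgD; first exact: cvg_cst.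
by apply: cvgMl; exact: cvg_id.
Qed.

(** A relational form in which derivability and value travel together, so that sums, multiples and
    averages are differentiated term by term. *)
Definition has_rderive f z v d :=
  is_derive (0 : R) 1 (fun t : R => complex.Re (along f z v t) : R) (complex.Re d) /\
  is_derive (0 : R) 1 (fun t : R => complex.Im (along f z v t) : R) (complex.Im d).

Lemma rderivableP f z v : rderivable f z v -> has_rderive f z v (rderive v f z).
Proof.
by case=> hr hi; split; rewrite /= derive1E; exact: derivableP.
Qed.

Lemma has_rderivableE f z v d :
  has_rderive f z v d -> rderivable f z v /\ rderive v f z = d.
Proof.
case=> hr hi; split.
  by split; [exact: (@ex_derive _ _ _ _ _ _ _ hr)|exact: (@ex_derive _ _ _ _ _ _ _ hi)].
rewrite /rderive !derive1E (@derive_val _ _ _ _ _ _ _ hr) (@derive_val _ _ _ _ _ _ _ hi).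
by case: d {hr hi}.
Qed.

Lemma has_rderive_near f g z v d : (\forall w \near z, f w = g w) ->
  has_rderive f z v d -> has_rderive g z v d.
Proof.
move=> fg.
have fgt : \forall t \near (0 : R), f (z + (t%:C)%C *: v) = g (z + (t%:C)%C *: v).

  have E : z + (0%:C)%C *: v = z by rewrite scale0r addr0.
  have K : nbhs (z + (0%:C)%C *: v) [set w | f w = g w] by rewrite E.
  exact: (@continuous_line z v 0 _ K).
case=> hr hi; split.
  apply: near_eq_is_derive hr; apply: filterS fgt => t; rewrite /along => -> //.
apply: near_eq_is_derive hi; apply: filterS fgt => t; rewrite /along => -> //.
Qed.

Lemma has_rderive_shift f z v p d :
  has_rderive (fun w => f (w + p)) z v d <-> has_rderive f (z + p) v d.
Proof.
rewrite /has_rderive /along.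
rewrite -![fun t => _ (f (z + _ + p))]/((_ \o f) \o fun t : R => z + (t%:C)%C *: v + p).
rewrite -![fun t => _ (f (z + p + _))]/((_ \o f) \o fun t : R => z + p + (t%:C)%C *: v).
suff -> : (fun t : R => z + (t%:C)%C *: v + p) = (fun t : R => z + p + (t%:C)%C *: v) by [].
by apply/funext => t; rewrite addrAC.
Qed.

Lemma has_rderive_cst z v d : has_rderive (fun=> d) z v 0.
Proof. by split; exact: is_derive_cst. Qed.

Lemma has_rderiveD f g z v d e : has_rderive f z v d -> has_rderive g z v e ->
  has_rderive (fun w => f w + g w) z v (d + e).
Proof.
case=> fr fi [gr gi]; split.
  rewrite Re_add (_ : (fun t => _) = (fun t : R => complex.Re (along f z v t) :
    R) + (fun t : R => complex.Re (along g z v t) : R)).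
    exact: is_deriveD.
  by apply/funext => t; rewrite /along Re_add.
rewrite Im_add (_ : (fun t => _) = (fun t : R => complex.Im (along f z v t) :
  R) + (fun t : R => complex.Im (along g z v t) : R)).
  exact: is_deriveD.
by apply/funext => t; rewrite /along Im_add.
Qed.

Lemma has_rderiveZ f z v d (c : C) : has_rderive f z v d ->
  has_rderive (fun w => c * f w) z v (c * d).
Proof.
case=> fr fi.
have h1 (a b : R) : is_derive (0 : R) 1 (fun t :
  R => a * complex.Re (along f z v t) + b * complex.Im (along f z v t) :
  R) (a * complex.Re d + b * complex.Im d).
  exact: (is_deriveD (is_deriveZ a fr) (is_deriveZ b fi)).
case: c => a b; split.
  have := h1 a (- b); rewrite (_ : a * _ + _ = complex.Re (Complex a b * d)); last first.
    by case: (d) => ? ?; rewrite /= mulNr.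
  congr (is_derive _ _ _ _); apply/funext => t; rewrite /along.
  by case: (f _) => ? ?; rewrite /= mulNr.
have := h1 b a; rewrite (_ : b * _ + _ = complex.Im (Complex a b * d)); last first.
  by case: (d) => ? ?; rewrite /= addrC.
congr (is_derive _ _ _ _); apply/funext => t; rewrite /along.
by case: (f _) => ? ?; rewrite /= addrC.
Qed.

Lemma has_rderive_sum (I : Type) (r : seq I) (F : I -> V -> C) z v (D : I -> C) :
  (forall i, has_rderive (F i) z v (D i)) ->
  has_rderive (fun w => \sum_(i <- r) F i w) z v (\sum_(i <- r) D i).
Proof.
move=> h; elim: r => [|i r IH].
  by under eq_fun do rewrite big_nil; rewrite big_nil; exact: has_rderive_cst.
under eq_fun do rewrite big_cons; rewrite big_cons.
exact: has_rderiveD.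
Qed.

Lemma is_derive_translate (h : R -> R) (t d : R) :
  is_derive (0 : R) 1 (fun u => h (t + u)) d -> is_derive t 1 h d.
Proof.
have E : (fun k : R => k^-1 *: ((h \o shift t) (k *: (1 : R)) - h t)) =
  (fun k : R => k^-1 *: (((fun u => h (t + u)) \o shift 0) (k *: (1 : R)) - h (t + 0))).
  by apply/funext => k /=; rewrite !addr0 [t + _]addrC.
case=> h1 h2; split; first by move: h1; rewrite /derivable -E.
by move: h2; rewrite /derive -E.
Qed.

End RealDerivative.

(** * Mean value inequalities *)

Section MeanValue.
Variable R : realType.
Local Notation C := (Cx R).
Variable n : nat.
Local Notation V := 'rV[C]_n.
Implicit Types (f g : V -> C) (z v w p : V) (t : R) (d : C).

Lemma has_rderive_at f z v t d : has_rderive f (z + (t%:C)%C *: v) v d ->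
  is_derive t 1 (fun u : R => complex.Re (along f z v u) : R) (complex.Re d) /\
  is_derive t 1 (fun u : R => complex.Im (along f z v u) : R) (complex.Im d).
Proof.
have E : along f (z + (t%:C)%C *: v) v = (fun u => along f z v (t + u)).
  by apply/funext => u; rewrite /along -addrA -scalerDl -rmorphD.
by rewrite /has_rderive E; case=> h1 h2; split; apply: is_derive_translate.
Qed.

Lemma real_mean_value (h dh : R -> R) (t d B : R) : 0 <= t ->
  (forall u, 0 <= u <= t -> is_derive u 1 h (dh u)) ->
  (forall u, 0 <= u <= t -> `|dh u - d| <= B) ->
  `|h t - h 0 - t * d| <= B * t.
Proof.
move=> t0 hd hB.
have [] := @MVT_segment R h dh 0 t t0.
- by move=> u; rewrite in_itv /= => /andP[/ltW u0 /ltW ut]; apply: hd; rewrite u0.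
- apply: derivable_within_continuous => u; rewrite in_itv /= => hu.
  exact: (@ex_derive _ _ _ _ _ _ _ (hd _ hu)).
move=> u; rewrite in_itv /= => hu ->;
  rewrite subr0 [t * d]mulrC -mulrBl normrM (ger0_norm t0).
by rewrite ler_wpM2r // hB.
Qed.

(** Real and imaginary parts have different intermediate points and are estimated separately; this
    costs the factor 2. *)
Lemma mean_value_ge0 f z v t d (B : R) : 0 <= t ->
  (forall u, 0 <= u <= t -> rderivable f (z + (u%:C)%C *: v) v) ->
  (forall u, 0 <= u <= t ->
     normc (rderive v f (z + (u%:C)%C *: v) - d) <= B) ->
  normc (f (z + (t%:C)%C *: v) - f z - (t%:C)%C * d) <= 2 * B * t.
Proof.
move=> t0 hd hB.
have hdv u : 0 <= u <= t -> _ := fun h => has_rderive_at (rderivableP (hd u h)).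
apply: le_trans (normc_le _) _.
rewrite !Re_add !Im_add !Re_opp !Im_opp Re_realM Im_realM.
rewrite -mulrA mulr2n mulrDl mul1r lerD //.
  have := @real_mean_value (fun u => complex.Re (along f z v u)) (fun u => complex.Re
    (rderive v f (z + (u%:C)%C *: v))) t (complex.Re d) B t0.
  rewrite /along scale0r addr0; apply => u hu; first by have [] := hdv u hu.
  by apply: le_trans (hB u hu); rewrite -Re_opp -Re_add Re_le_normc.
have := @real_mean_value (fun u => complex.Im (along f z v u)) (fun u => complex.Im
  (rderive v f (z + (u%:C)%C *: v))) t (complex.Im d) B t0.
rewrite /along scale0r addr0; apply => u hu; first by have [] := hdv u hu.
by apply: le_trans (hB u hu); rewrite -Im_opp -Im_add Im_le_normc.
Qed.

Lemma mean_value f z v t d (B : R) :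
  (forall u, 0 <= u <= t \/ t <= u <= 0 -> rderivable f (z + (u%:C)%C *: v) v) ->
  (forall u, 0 <= u <= t \/ t <= u <= 0 ->
     normc (rderive v f (z + (u%:C)%C *: v) - d) <= B) ->
  normc (f (z + (t%:C)%C *: v) - f z - (t%:C)%C * d) <= 2 * B * `|t|.
Proof.
move=> hd hB; have [t0|t0] := leP 0 t.
  by rewrite (ger0_norm t0); apply: mean_value_ge0 => // u hu;
    [apply: hd|apply: hB]; left.
(* For t < 0 the segment is run backwards from its other end. *)
pose z' := z + (t%:C)%C *: v.
have zE u : z' + (u%:C)%C *: v = z + ((t + u)%:C)%C *: v.
  by rewrite /z' -addrA -scalerDl -rmorphD.
have := @mean_value_ge0 f z' v (- t) d B.
rewrite !zE subrr scale0r addr0 (ltr0_norm t0) => h.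
rewrite -[X in normc X]opprK normcN.
have -> : - (f (z + (t%:C)%C *: v) - f z - (t%:C)%C * d) = f z - f z' - ((- t)%:C)%C * d.
  by rewrite rmorphN /= mulNr opprK !opprD !opprK [- _ + f z]addrC.
apply: h; first lra.
  move=> u /andP[u0 ut]; rewrite zE; apply: hd; right; apply/andP; split; lra.
move=> u /andP[u0 ut]; rewrite zE; apply: hB; right; apply/andP; split; lra.
Qed.

End MeanValue.

(** * Locality of the smoothness classes *)

Section SmoothClass.
Variable R : realType.
Local Notation C := (Cx R).
Variable n : nat.
Local Notation V := 'rV[C]_n.
Implicit Types (f g : V -> C) (z v w p : V) (W Y : set V).

Lemma rderive_near f g z v : (\forall w \near z, f w = g w) ->
  rderivable f z v -> rderivable g z v /\ rderive v f z = rderive v g z.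
Proof.
move=> fg /rderivableP /(has_rderive_near fg) /has_rderivableE[? ->].
by split.
Qed.

Lemma continuous_near f g z : (\forall w \near z, f w = g w) ->
  {for z, continuous f} -> {for z, continuous g}.
Proof.
move=> fg; rewrite /prop_for /continuous_at -(nbhs_singleton fg) => h.
exact: cvg_trans (near_eq_cvg fg) h.
Qed.

Lemma Ck_near m W f g : open W -> (forall z, W z -> f z = g z) ->
  Ck m W f -> Ck m W g.
Proof.
move=> oW; have oWn (h k : V -> C) : (forall z, W z -> h z = k z) ->
    forall z, W z -> \forall w \near z, h w = k w.
  by move=> hk z Wz; have := open_nbhs_nbhs (conj oW Wz); apply: filterS.
elim: m f g => [|m IH] f g fg /= [cf df].
  split; last by [].
  by move=> z Wz; exact: (continuous_near (oWn _ _ fg z Wz) (cf z Wz)).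
split=> [z Wz|v]; first exact: (continuous_near (oWn _ _ fg z Wz) (cf z Wz)).
have [d1 d2] := df v.
have H z : W z -> _ := fun Wz => rderive_near (oWn _ _ fg z Wz) (d1 z Wz).
by split=> [z /H[]//|]; apply: IH d2 => z /H[].
Qed.

(** All conditions in [Ck] are imposed point by point, so [Y] need be neither open nor contained in
    [W]: this serves both to restrict to a subset and to glue over charts. *)
Lemma Ck_local m W f :
  (forall z, W z -> exists Y, Y z /\ Ck m Y f) -> Ck m W f.
Proof.
elim: m f => [|m IH] f h /=.
  by split=> // z /h[Y [Yz [+ _]]]; apply.
split=> [z /h[Y [Yz [+ _]]]|v]; first by apply.
split=> [z /h[Y [Yz [_ /(_ v)[+ _]]]]|]; first by apply.
by apply: IH => z /h[Y [Yz [_ /(_ v)[_ +]]]]; exists Y.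
Qed.

Lemma smooth_on_rderive W f v : smooth_on W f -> smooth_on W (rderive v f).
Proof. by move=> h m; have [_ /(_ v)[]] := h m.+1. Qed.

Lemma smooth_on_rderivable W f v z : smooth_on W f -> W z -> rderivable f z v.
Proof. by move=> h Wz; have [_ /(_ v)[+ _]] := h 1%N; apply. Qed.

Lemma smooth_on_continuous W f z : smooth_on W f -> W z -> {for z, continuous f}.
Proof. by move=> h Wz; have [+ _] := h 0%N; apply. Qed.

Lemma rderive_shift f z v p : rderivable f (z + p) v ->
  rderivable (fun w => f (w + p)) z v /\
  rderive v (fun w => f (w + p)) z = rderive v f (z + p).
Proof.
by move=> /rderivableP h; apply/has_rderivableE/has_rderive_shift.
Qed.

End SmoothClass.

(** * Averages along lines *)

Section Averages.
Variable R : realType.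
Local Notation C := (Cx R).
Variable n : nat.
Local Notation V := 'rV[C]_n.
Implicit Types (f g h : V -> C) (z v w p y : V) (S : set V) (B : R) (k : nat).

(** The mean over (k+1)^2 points spaced 1/(k+1) apart: a single parameter sends the step to 0 and
    the length of the segment, about k+1, to infinity. *)
Definition line_avg k v f : V -> C := fun z =>
  (((k.+1 ^ 2)%:R^-1 : R)%:C)%C *
    \sum_(i < k.+1 ^ 2) f (z + ((i%:R / k.+1%:R : R)%:C)%C *: v).

Definition torus_avg k (s : seq V) f : V -> C := foldr (line_avg k) f s.

Definition translation_stable S v := forall z (t : R), S z -> S (z + (t%:C)%C *: v).

Definition bounded_on S f B := forall z, S z -> normc (f z) <= B.

Lemma normc_sum (I : Type) (r : seq I) (F : I -> C) :
  normc (\sum_(i <- r) F i) <= \sum_(i <- r) normc (F i).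
Proof.
elim/big_ind2: _ => [||//]; first by rewrite normc0.
by move=> a b c d h1 h2; apply: le_trans (le_normcD _ _) (lerD h1 h2).
Qed.

Lemma mean_bounded k (B : R) (F : 'I_(k.+1 ^ 2) -> C) : (forall i, normc (F i) <= B) ->
  normc ((((k.+1 ^ 2)%:R^-1 : R)%:C)%C * \sum_i F i) <= B.
Proof.
move=> hF; rewrite normcM normc_real ger0_norm ?invr_ge0 ?ler0n //.
rewrite ler_pdivrMl ?ltr0n ?expn_gt0 //.
apply: le_trans (normc_sum _ _) _.
apply: le_trans (ler_sum _ (fun i _ => hF i)) _.
by rewrite sumr_const card_ord mulr_natl.
Qed.

Lemma line_avg_bounded S k v f B : translation_stable S v -> bounded_on S f B ->
  bounded_on S (line_avg k v f) B.
Proof. by move=> st hf z Sz; apply: mean_bounded => i; apply/hf/st. Qed.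

Lemma torus_avg_bounded S k s f B : (forall v, v \in s -> translation_stable S v) ->
  bounded_on S f B -> bounded_on S (torus_avg k s f) B.
Proof.
elim: s => //= v s IH st hf; apply: line_avg_bounded; first exact/st/mem_head.
by apply: IH => // w ws; apply: st; rewrite inE ws orbT.
Qed.

Lemma line_avgC k v w f : line_avg k v (line_avg k w f) = line_avg k w (line_avg k v f).
Proof.
apply/funext => z; rewrite /line_avg -!mulr_sumr exchange_big /=; do 2 congr (_ * _).
by apply: eq_bigr => i _; apply: eq_bigr => j _; rewrite addrAC.
Qed.

Lemma line_avg_torus_avg k v s f : line_avg k v (torus_avg k s f)
  = torus_avg k s (line_avg k v f).
Proof. by elim: s => //= w s IH; rewrite line_avgC IH. Qed.

Lemma line_avg_rderive S k v f g y : translation_stable S v ->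
  (forall z, S z -> has_rderive f z y (g z)) ->
  forall z, S z -> has_rderive (line_avg k v f) z y (line_avg k v g z).
Proof.
move=> st h z Sz; apply: has_rderiveZ; apply: has_rderive_sum => i.
by apply/has_rderive_shift/h/st.
Qed.

Lemma torus_avg_rderive S k s f g y : (forall v, v \in s -> translation_stable S v) ->
  (forall z, S z -> has_rderive f z y (g z)) ->
  forall z, S z -> has_rderive (torus_avg k s f) z y (torus_avg k s g z).
Proof.
elim: s => //= v s IH st h; apply: line_avg_rderive; first exact/st/mem_head.
by apply: IH => // w ws; apply: st; rewrite inE ws orbT.
Qed.

(* The derivative is compared with the difference quotient of step 1/(k+1),
   whose average telescopes. *)
Lemma line_avg_of_rderive S k v f (B0 B2 : R) : translation_stable S v ->
  (forall z, S z -> rderivable f z v) ->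
  (forall z, S z -> rderivable (rderive v f) z v) ->
  bounded_on S f B0 -> bounded_on S (rderive v (rderive v f)) B2 ->
  bounded_on S (line_avg k v (rderive v f)) ((2 * B0 + 4 * B2) / k.+1%:R).
Proof.
move=> st d1 d2 hB0 hB2 z Sz; set N : R := k.+1%:R.
have N0 : 0 < N by rewrite ltr0n.
pose g := rderive v f; pose del : R := N^-1.
have del0 : 0 < del by rewrite invr_gt0.
have B20 : 0 <= B2 by apply: le_trans (hB2 z Sz); exact: normc_ge0.
(* Over one grid step the derivative varies by O([del]), so the increment of [f] agrees with
   [del * g] up to O([del]^2). *)
have gvar x u : S x -> `|u| <= del -> normc (g (x + (u%:C)%C *: v) - g x) <= 2 * B2 * del.
  move=> Sx hu; have := @mean_value _ _ g x v u 0 B2.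
  rewrite mulr0 subr0 => h; apply: le_trans (h _ _) _.
  - by move=> t _; apply/d2/st.
  - by move=> t _; rewrite subr0; apply/hB2/st.
  - by rewrite ler_wpM2l // mulr_ge0.
have step x : S x ->
    normc (f (x + (del%:C)%C *: v) - f x - (del%:C)%C * g x) <= 4 * B2 * del * del.
  move=> Sx; have := @mean_value _ _ f x v del (g x) (2 * B2 * del).
  rewrite (gtr0_norm del0) => h; have ->
    : 4 * B2 * del * del = 2 * (2 * B2 * del) * del by ring.
  apply: h => u hu; [exact/d1/st|apply: gvar => //].
  by rewrite ler_norml; case: hu => /andP[]; lra.
pose x (i : nat) : V := z + ((i%:R / N : R)%:C)%C *: v.
have Sx i : S (x i) by exact: st.
have xS i : x i.+1 = x i + (del%:C)%C *: v.
  by rewrite /x -addrA -scalerDl -rmorphD /= -[i.+1]addn1 natrD mulrDl mul1r.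
have -> : line_avg k v g z = (((k.+1 ^ 2)%:R^-1 : R)%:C)%C *
   (\sum_(i < k.+1 ^ 2) (g (x i) - (N%:C)%C * (f (x i.+1) - f (x i)))) +
   (((k.+1 ^ 2)%:R^-1 : R)%:C)%C * ((N%:C)%C * (f (x (k.+1 ^ 2)%N) - f (x 0%N))).
  rewrite -mulrDr; congr (_ * _); rewrite sumrB -mulr_sumr.
  rewrite -(big_mkord xpredT (fun i => f (x i.+1) - f (x i))) telescope_sumr //.
  by rewrite subrK.
rewrite addrC mulrDl.
(* The telescoped boundary term carries N^-2 * N, whence 2 B0 / N; each local error is N times 4 B2
   / N^2. *)
apply: le_trans (le_normcD _ _) _; apply: lerD.
  rewrite !normcM !normc_real !ger0_norm ?invr_ge0 ?ler0n ?(ltW N0) //.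
  rewrite natrX -/N mulrA (_ : N ^- 2 * N = N^-1); last by field; rewrite gt_eqF.
  rewrite mulrC ler_wpM2r ?invr_ge0 ?(ltW N0) // mulr2n mulrDl mul1r.
  by apply: le_trans (le_normcD _ _) _; rewrite normcN lerD ?hB0.
apply: mean_bounded => i; rewrite xS.
have -> : g (x i) - (N%:C)%C * (f (x i + (del%:C)%C *: v) - f (x i)) =
  - ((N%:C)%C * (f (x i + (del%:C)%C *: v) - f (x i) - (del%:C)%C * g (x i))).
  rewrite [in RHS]mulrBr opprB mulrA -rmorphM /= divff ?gt_eqF // mul1r //.
rewrite normcN normcM normc_real (gtr0_norm N0).
apply: le_trans (ler_wpM2l (ltW N0) (step _ (Sx i))) _.
by rewrite le_eqVlt; apply/orP; left; apply/eqP; rewrite /del; field; rewrite gt_eqF.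
Qed.

(** Averages in different directions commute, so the one along [v] can be applied first to the
    derivative; the others preserve its bound. *)
Lemma torus_avg_of_rderive S k s v f (B0 B2 : R) :
  (forall w, w \in s -> translation_stable S w) -> v \in s ->
  (forall z, S z -> rderivable f z v) ->
  (forall z, S z -> rderivable (rderive v f) z v) ->
  bounded_on S f B0 -> bounded_on S (rderive v (rderive v f)) B2 ->
  bounded_on S (torus_avg k s (rderive v f)) ((2 * B0 + 4 * B2) / k.+1%:R).
Proof.
move=> st vs d1 d2 b0 b2; elim: s st vs => //= w s IH st.
have sts v' : v' \in s -> translation_stable S v' by move=> h; apply: st;
  rewrite inE h orbT.
rewrite inE => /predU1P[vw|vs].
  rewrite (line_avg_torus_avg k w s); apply: (torus_avg_bounded k sts);
    rewrite vw in d1 d2 b2 *.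
  exact: (line_avg_of_rderive k (st w (mem_head w s)) d1 d2 b0 b2).
apply: line_avg_bounded; [exact/st/mem_head|exact: IH sts vs].
Qed.

End Averages.

(** * Pluriclosed metrics with averaged coefficients *)

Section DdcExpansion.
Variable R : realType.
Local Notation C := (Cx R).
Variable n : nat.
Local Notation V := 'rV[C]_n.
Implicit Types (f g : V -> C) (z v w : V) (W : set V).

Lemma smooth_on_lincomb W f g (a b : C) : open W ->
  smooth_on W f -> smooth_on W g -> smooth_on W (fun z => a * f z + b * g z).
Proof.
move=> oW hf hg m.
elim: m f g hf hg => [|m IH] f g hf hg; split.
- move=> z Wz; have cf := smooth_on_continuous hf Wz.
  have cg := smooth_on_continuous hg Wz.
  exact: (cvgD (cvgM (cvg_cst a) cf) (cvgM (cvg_cst b) cg)).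
- by [].
- move=> z Wz; have cf := smooth_on_continuous hf Wz.
  have cg := smooth_on_continuous hg Wz.
  exact: (cvgD (cvgM (cvg_cst a) cf) (cvgM (cvg_cst b) cg)).
move=> v.
have H z : W z -> has_rderive (fun z => a * f z + b * g z) z v (a * rderive v f z + b *
  rderive v g z).
  move=> Wz; apply: has_rderiveD; apply/has_rderiveZ/rderivableP.
    exact: smooth_on_rderivable hf Wz.
  exact: smooth_on_rderivable hg Wz.
split=> [z /H/has_rderivableE[]//|].
apply: (@Ck_near _ _ m W (fun z => a * rderive v f z + b * rderive v g z)) => //.
  by move=> z /H/has_rderivableE[].
by apply: IH; apply: smooth_on_rderive.
Qed.

Lemma smooth_on_ext W f g : open W -> (forall z, W z -> f z = g z) ->
  smooth_on W f -> smooth_on W g.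
Proof. by move=> oW fg hf m; apply: Ck_near (hf m). Qed.

Lemma rderive_eq_on W f g v z : open W -> (forall w, W w -> f w = g w) ->
  W z -> rderivable f z v -> rderive v g z = rderive v f z.
Proof.
move=> oW fg Wz d; have fgn : \forall w \near z, f w = g w.
  by have := open_nbhs_nbhs (conj oW Wz); apply: filterS.
by have [_ ->] := rderive_near fgn d.
Qed.

Definition real_dir (j : 'I_n) : V := delta_mx 0 j.
Definition imag_dir (j : 'I_n) : V := 'i *: delta_mx 0 j.

(** The Wirtinger operators in the shape [a * f + b * g], to which the closure lemmas for linear
    combinations apply directly. *)
Definition wbar (j : 'I_n) f : V -> C :=
  fun z => 2^-1 * rderive (real_dir j) f z + ('i / 2) * rderive (imag_dir j) f z.
Definition wdel (j : 'I_n) f : V -> C :=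
  fun z => 2^-1 * rderive (real_dir j) f z + (- 'i / 2) * rderive (imag_dir j) f z.

Lemma wirtinger_barE j f : wirtinger_bar j f = wbar j f.
Proof. by apply/funext => z; rewrite /wirtinger_bar /wbar mulrDl mulrAC [_^-1 * _]mulrC.
  Qed.

Lemma wirtingerE j f : wirtinger j f = wdel j f.
Proof. by apply/funext => z; rewrite /wirtinger /wdel mulrBl mulrAC [_^-1 * _]mulrC
  !mulNr. Qed.

Lemma smooth_on_wbar W j f : open W -> smooth_on W f -> smooth_on W (wbar j f).
Proof. by move=> oW hf; apply: smooth_on_lincomb => //; apply: smooth_on_rderive. Qed.

Lemma rderive_scale_on W f v z (a : C) : smooth_on W f -> W z ->
  rderive v (fun w => a * f w) z = a * rderive v f z.
Proof.
move=> hf Wz; have := has_rderiveZ a (rderivableP (smooth_on_rderivable v hf Wz)).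
by move=> /has_rderivableE[].
Qed.

Lemma wbar_scale W f j z (a : C) : smooth_on W f -> W z ->
  wbar j (fun w => a * f w) z = a * wbar j f z.
Proof. by move=> hf Wz; rewrite /wbar !(rderive_scale_on _ _ hf Wz);
  move: (rderive _ f z) (rderive (imag_dir j) f z) => x y; ring. Qed.

Lemma wdel_lincomb W f g j z (a b : C) : smooth_on W f -> smooth_on W g -> W z ->
  wdel j (fun w => a * f w + b * g w) z = a * wdel j f z + b * wdel j g z.
Proof.
move=> hf hg Wz; rewrite /wdel.
have H v : rderive v (fun w => a * f w + b * g w) z = a * rderive v f z + b * rderive v g z.
  have [] // := @has_rderivableE _ _ (fun z => a * f z + b * g z) z v (a * rderive v f z
    + b * rderive v g z).
  apply: has_rderiveD; apply/has_rderiveZ/rderivableP.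
    exact: smooth_on_rderivable hf Wz.
  exact: smooth_on_rderivable hg Wz.
rewrite !H; move: (rderive _ f z) (rderive _ g z) (rderive (imag_dir j) f z) (rderive
  (imag_dir j) g z).
move=> x y x' y'; ring.
Qed.

Lemma wdel_eq_on W f g j z : open W -> (forall w, W w -> f w = g w) ->
  smooth_on W f -> W z -> wdel j g z = wdel j f z.
Proof.
move=> oW fg hf Wz; rewrite /wdel !(rderive_eq_on oW fg Wz) //;
  exact: smooth_on_rderivable hf Wz.
Qed.

Lemma lift_ord2 : (lift (ord0 : 'I_2) ord0 = ord_max) * (lift (ord_max : 'I_2) ord0 = ord0).
Proof. by split; apply/val_inj. Qed.

(** The second derivatives T p q r s are antisymmetrised in (p, r) and in (q, s). The factor -i is
    the i of the fundamental form times the sign (-1)^1 of [delbar] on a form with one dz. *)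
Lemma ddc_expand W (H : V -> 'M[C]_n) (J K : 'I_2 -> 'I_n) z : open W ->
  (forall j k, smooth_on W (fun z => H z j k)) -> W z ->
  let T p q r s := wdel p (wbar q (fun z => H z r s)) z in
  let j := J ord0 in let a := J ord_max in
  let k := K ord0 in let b := K ord_max in
  del (delbar (fundamental_form H)) J K z =
  - 'i * ((T j k a b - T j b a k) - (T a k j b - T a b j k)).
Proof.
move=> oW sH Wz T j a k b.
have key (J' : 'I_1 -> 'I_n) w : W w ->
   delbar (fundamental_form H) J' K w =
   - 'i * wbar k (fun z => H z (J' ord0) b) w + 'i * wbar b (fun z => H z (J' ord0) k) w.
  move=> Ww; rewrite /delbar /fundamental_form expr1 big_ord_recl big_ord1 /=
    !wirtinger_barE.
  rewrite !(wbar_scale _ _ (sH _ _) Ww) !lift_ord2 expr0 expr1 mul1r.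
  rewrite -/k -/b.
  move: (wbar k _ w) (wbar b _ w) => x y; ring.
have sm r (c d : 'I_n) : smooth_on W (fun w => - 'i * wbar c (fun z => H z r d) w + 'i *
  wbar d (fun z => H z r c) w).
  by apply: smooth_on_lincomb => //; apply: smooth_on_wbar.
have key2 (p : 'I_n) (J' : 'I_1 -> 'I_n) : wdel p (delbar (fundamental_form H) J' K) z =
   - 'i * T p k (J' ord0) b + 'i * T p b (J' ord0) k.
  rewrite (wdel_eq_on p oW _ (sm (J' ord0) k b) Wz); last by move=> w /key ->.
  by apply: wdel_lincomb Wz; apply: smooth_on_wbar.
rewrite /del big_ord_recl big_ord1 /= !wirtingerE !key2 /= !lift_ord2 expr0 expr1 mul1r.
rewrite -/j -/a.
move: (T j k a b) (T j b a k) (T a k j b) (T a b j k) => x y x' y'; ring.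
Qed.

End DdcExpansion.

(** * Averages along the torus directions *)

Section TorusAverage.
Variable R : realType.
Local Notation C := (Cx R).
Variables s t : nat.
Local Notation V := 'rV[C]_(s + t).
Implicit Types (f g : V -> C) (z v w : V).
Local Notation rI := (@lshift s t).
Local Notation cI := (@rshift s t).

(** Real parts and complex coordinates stay free, so the set is stable under all torus directions;
    periodicity will stand in for compactness. *)
Definition imbox (al be : R) : set V :=
  [set z | forall j : 'I_s, al <= complex.Im (z 0 (rI j)) <= be].

(** A real basis of R^s x C^t: every real direction of C^(s+t) except the y_j. *)
Definition torus_dirs : seq V :=
  [seq real_dir R (rI j) | j <- enum 'I_s] ++
  ([seq real_dir R (cI a) | a <- enum 'I_t] ++ [seq imag_dir R (cI a) | a <- enum 'I_t]).

Lemma torus_dirs_Im v (j : 'I_s) : v \in torus_dirs -> complex.Im (v 0 (rI j)) = 0.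
Proof.
rewrite !mem_cat => /or3P[] /mapP[i _ ->]; rewrite !mxE eqxx /=.
- by case: eqP.
- by rewrite eq_lrshift.
- by rewrite eq_lrshift mulr0.
Qed.

Lemma stable_torus_dirs al be v : v \in torus_dirs -> translation_stable (imbox al be) v.
Proof. by move=> vd z u zS j; rewrite !mxE Im_add Im_realM (torus_dirs_Im _ vd) mulr0
  addr0. Qed.

Local Notation Omega := (@OT_domain R s t).

Lemma imbox_sub al be : 0 < al -> imbox al be `<=` Omega.
Proof. by move=> al0 z zS j; have /andP[h _] := zS j; exact: lt_le_trans h. Qed.

Lemma open_OT_domain : open Omega.
Proof.
rewrite openE => z zO; rewrite /interior.
apply: (@filter_forall _ _ (fun (j : 'I_s) (w :
  V) => 0 < complex.Im (w 0 (rI j))) (nbhs z) (nbhs_filter z)) => j.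
have c : {for z, continuous (fun w : V => complex.Im (w 0 (rI j)) : R)}.
  apply: (@continuous_comp _ _ _ (fun w : V => w 0 (rI j) : C) (fun x :
    C => complex.Im x : R)).
    exact: coord_continuous.
  exact: continuous_Im.
by apply: (c [set x | 0 < x]); apply: open_nbhs_nbhs; split; [exact: open_gt|exact: zO].
Qed.

Lemma torus_avg_lincomb m (r : seq V) f g (a b : C) :
  torus_avg m r (fun z => a * f z + b * g z)
    = fun z => a * torus_avg m r f z + b * torus_avg m r g z.
Proof.
elim: r => //= v r ->; apply/funext => z; rewrite /line_avg big_split /= -!mulr_sumr.
by rewrite mulrDr !(mulrCA _ a) !(mulrCA _ b).
Qed.

Lemma torus_avg_eq_on (S : set V) m (r : seq V) f g : (forall v, v \in r ->
  translation_stable S v) ->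
  (forall z, S z -> f z = g z) -> forall z, S z -> torus_avg m r f z = torus_avg m r g z.
Proof.
elim: r => //= v r IH st fg z Sz; rewrite /line_avg; congr (_ * _); apply: eq_bigr => i _.
apply: IH => //; first by move=> w wr; apply: st; rewrite inE wr orbT.
by apply: st => //; exact: mem_head.
Qed.

(** The quantitative form of having mean zero over the torus, locally uniformly in y. *)
Definition decays f := forall al be : R, 0 < al ->
  exists K, forall m, bounded_on (imbox al be) (torus_avg m torus_dirs f) (K / m.+1%:R).

Lemma decays_lincomb f g (a b : C) : decays f -> decays g ->
  decays (fun z => a * f z + b * g z).
Proof.
move=> hf hg al be al0; have [K hK] := hf al be al0; have [L hL] := hg al be al0.
exists (normc a * K + normc b * L) => m z Sz; rewrite torus_avg_lincomb mulrDl.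
apply: le_trans (le_normcD _ _) _; rewrite !normcM -!mulrA.
by apply: lerD; rewrite ler_wpM2l ?normc_ge0 //; [exact: hK|exact: hL].
Qed.

Lemma decays_ext f g : (forall z, Omega z -> f z = g z) -> decays f -> decays g.
Proof.
move=> fg hf al be al0; have [K hK] := hf al be al0; exists K => m z Sz.
rewrite -(torus_avg_eq_on (S := imbox al be) _ _ (f := f)) //; first exact: hK.
  by move=> v; exact: stable_torus_dirs.
by move=> w /(imbox_sub al0); exact: fg.
Qed.

End TorusAverage.

(** * The affine limit of an averaged diagonal coefficient *)

Section PluriclosedAverage.
Variable R : realType.
Local Notation C := (Cx R).
Variables s t : nat.
Local Notation V := 'rV[C]_(s + t).
Implicit Types (f g : V -> C) (z v w : V).
Local Notation rI := (@lshift s t).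
Local Notation cI := (@rshift s t).
Local Notation Omega := (@OT_domain R s t).

(** Stands for the smooth O_K-periodic functions ([OK_nice] below); the averaging argument sees only
    these closure properties and not the number field. *)
Variable nice : (V -> C) -> Prop.
Hypothesis nice_smooth : forall f, nice f -> smooth_on Omega f.
Hypothesis nice_bounded : forall f (al be : R), nice f -> 0 < al ->
  exists B, bounded_on (imbox al be) f B.
Hypothesis nice_rderive : forall f v, nice f -> nice (rderive v f).
Hypothesis nice_lincomb : forall f g (a b : C), nice f -> nice g ->
  nice (fun z => a * f z + b * g z).

Lemma decays_rderive f v : nice f -> v \in torus_dirs R s t -> decays (rderive v f).
Proof.
move=> nf vd al be al0.
have [B0 hB0] := nice_bounded be nf al0.
have [B2 hB2] := nice_bounded be (nice_rderive v (nice_rderive v nf)) al0.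
exists (2 * B0 + 4 * B2) => m; apply: torus_avg_of_rderive vd _ _ hB0 hB2.
- by move=> w; exact: stable_torus_dirs.
- by move=> z /(imbox_sub al0); apply: smooth_on_rderivable (nice_smooth nf).
- by move=> z /(imbox_sub al0);
  apply: smooth_on_rderivable (nice_smooth (nice_rderive v nf)).
Qed.

Lemma nice_wbar k f : nice f -> nice (wbar k f).
Proof. by move=> nf; apply: nice_lincomb; apply: nice_rderive. Qed.

Variable H : V -> 'M[C]_(s + t).
Hypothesis nice_H : forall j k, nice (fun z => H z j k).
Hypothesis pcH : forall J K z, Omega z -> del (delbar (fundamental_form H)) J K z = 0.
Variable a : 'I_t.
Local Notation A := (cI a).
Local Notation h j k := (fun z => H z j k).

Lemma real_dir_torus j : real_dir R j \in torus_dirs R s t.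
Proof.
rewrite !mem_cat; case: (split_ordP j) => i ->; apply/orP.
  by left; apply: map_f; rewrite mem_enum.
by right; apply/orP; left; apply: map_f; rewrite mem_enum.
Qed.

Lemma imag_dir_torus b : imag_dir R (cI b) \in torus_dirs R s t.
Proof. by rewrite !mem_cat (map_f (fun a => imag_dir R (cI a))) ?mem_enum // !orbT. Qed.

(* With f the coefficient of dw_a dwbar_a, the derivative of f along y_k is
   -2i drift_main + drift_rest, where drift_rest is a sum of derivatives along the
   torus, and so is the derivative of drift_main along any y_j when the metric is
   pluriclosed. *)
Definition drift_main (k : 'I_s) : V ->
  C := fun z => 1 * wbar (rI k) (h A A) z + - 1 * wbar A (h A (rI k)) z.
Definition drift_aux (j k : 'I_s) : V ->
  C := fun z => 1 * wbar A (h (rI j) (rI k)) z + - 1 * wbar (rI k) (h (rI j) A) z.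
Definition drift_rest (k : 'I_s) : V -> C := fun z =>
  'i * rderive (real_dir R (rI k)) (h A A) z + 1 * (
  - 'i * rderive (real_dir R A) (h A (rI k)) z + 1 * rderive (imag_dir R A) (h A (rI k)) z).

Lemma nice_drift_main k : nice (drift_main k).
Proof. by apply: nice_lincomb; apply: nice_wbar. Qed.

Lemma nice_drift_aux j k : nice (drift_aux j k).
Proof. by apply: nice_lincomb; apply: nice_wbar. Qed.

Lemma decays_drift_rest k : decays (drift_rest k).
Proof.
apply: decays_lincomb; first by apply: decays_rderive; rewrite ?real_dir_torus.
by apply: decays_lincomb; apply: decays_rderive; rewrite ?real_dir_torus ?imag_dir_torus.
Qed.

Lemma mul_ii : 'i * 'i = -1 :> C.
Proof. by rewrite -expr2 sqrCi. Qed.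

(** Since dbar = (d_x + i d_y) / 2, one has d_y = -2i dbar + i d_x. The correction term of
    [drift_main] is undone by the derivatives along w_a in [drift_rest]; it is there so that d_j of
    [drift_main] is a combination of terms of the pluriclosed equation. *)
Lemma rderive_drift_split k z : rderive (imag_dir R (rI k)) (h A A) z
  = (- 'i * 2) * drift_main k z + 1 * drift_rest k z.
Proof.
rewrite /drift_main /drift_rest /wbar.
move: (rderive _ _ z) (rderive (real_dir R _) _ z) (rderive (imag_dir R A) _ z) (rderive
  (real_dir R A) _ z) => x x' y y'.
have := mul_ii; move: ('i : C) => i ii.
(* Multiples of 1 + i^2 = 0 are inserted so that [field], which treats i as a variable, can
   conclude. *)
transitivity (x - (1 + i * i) * x + (1 + i * i) * y);
  first by rewrite ii subrr !mul0r subr0 addr0.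
by field.
Qed.

(** The equation says d_j([drift_main]) + d_A([drift_aux]) = 0. Here x, y are the derivatives of
    [drift_aux] along w_a, and x', y' those of [drift_main] along x_j, y_j; the relation is solved
    for y'. *)
Lemma ddc_solve (i x y x' y' t1 t2 t3 t4 : C) : i * i = -1 ->
  2^-1 * x + - i / 2 * y = 1 * t4 + -1 * t3 ->
  2^-1 * x' + - i / 2 * y' = 1 * t1 + -1 * t2 ->
  - i * (t1 - t2 - (t3 - t4)) = 0 ->
  - i * x' + 1 * (- i * x + -1 * y) = y'.
Proof.
move=> ii e1 e2 e3.
have e : t1 - t2 - (t3 - t4) = 0.
  have -> : t1 - t2 - (t3 - t4) = i * (- i * (t1 - t2 - (t3 - t4)))
    by rewrite mulrA mulrN ii opprK mul1r.
  by rewrite e3 mulr0.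
have e4 : (2^-1 * x' + - i / 2 * y') + (2^-1 * x + - i / 2 * y) = 0.
  by rewrite e1 e2 -[RHS]e; ring.
have -> : y' = y' - 2 * i * (2^-1 * x' + - i / 2 * y' + (2^-1 * x + - i / 2 * y))
  by rewrite e4 mulr0 subr0.
transitivity (y' - i * x' + (i * i) * y' - i * x + (i * i) * y); first by rewrite ii; ring.
by field.
Qed.

Lemma decays_rderive_drift_main j k : decays (rderive (imag_dir R (rI j)) (drift_main k)).
Proof.
pose T z : C := - 'i * rderive (real_dir R (rI j)) (drift_main k) z + 1 *
  (- 'i * rderive (real_dir R A) (drift_aux j k) z + -1 * rderive (imag_dir R A)
    (drift_aux j k) z).
apply: (@decays_ext _ _ _ T).
  move=> z Oz.
  pose J (i : 'I_2) : 'I_(s + t) := if i == ord0 then rI j else A.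
  pose K (i : 'I_2) : 'I_(s + t) := if i == ord0 then rI k else A.
  have sm p q : smooth_on Omega (h p q) by apply: nice_smooth.
  have smw b p q : smooth_on Omega (wbar b (h p q)) by apply: nice_smooth; apply: nice_wbar.
  have e3 := pcH J K Oz.
  rewrite (ddc_expand J K (@open_OT_domain R s t) sm Oz) /J /K /= in e3.
  have e2 := wdel_lincomb (rI j) 1 (-1) (smw (rI k) A A) (smw A A (rI k)) Oz.
  have e1 := wdel_lincomb A 1 (-1) (smw A (rI j) (rI k)) (smw (rI k) (rI j) A) Oz.
  exact: (ddc_solve mul_ii e1 e2 e3).
apply: decays_lincomb; first by apply: decays_rderive;
  [exact: nice_drift_main|exact: real_dir_torus].
by apply: decays_lincomb; apply: decays_rderive;
  rewrite ?real_dir_torus ?imag_dir_torus //; exact: nice_drift_aux.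
Qed.

Definition imag_point (y : 'I_s -> R) : V :=
  \row_(i < s + t) (if fintype.split i is inl j then Complex 0 (y j) : C else 0).

Lemma imag_point_real y j : imag_point y 0 (rI j) = Complex 0 (y j).
Proof. by rewrite mxE (@unsplitK s t (inl _ j)). Qed.

Lemma imag_point_imbox y (al be : R) : (forall j, al <= y j <= be) ->
  imbox al be (imag_point y).
Proof. by move=> hy j; rewrite imag_point_real; exact: hy. Qed.

Lemma imag_point_shift y j (u : R) :
  imag_point y + (u%:C)%C *: imag_dir R (rI j)
    = imag_point (fun i => y i + (if i == j then u else 0)).
Proof.
apply/rowP => i; rewrite !mxE eqxx /=; case: (split_ordP i) => k ->.
  rewrite eq_lshift -complexiE; case: eqP => _.
    by rewrite mulr1; apply/eqP; rewrite eq_complex /=; apply/andP; split; apply/eqP; ring.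
  by rewrite !mulr0 !addr0.
by rewrite eq_rlshift !mulr0 addr0.
Qed.

(** The point (1, .., 1) is joined to y by changing one coordinate at a time; as al <= 1 <= be, all
    corners stay in the box, and each of the s legs contributes one [eps]. *)
Lemma axis_path (Phi : V -> C) (d : 'I_s -> C) (al be eps : R) (y : 'I_s -> R) :
  al <= 1 -> 1 <= be -> (forall i, al <= y i <= be) ->
  (forall x j u, (forall i, al <= x i <= be) -> al <= x j + u <= be ->
    normc (Phi (imag_point x + (u%:C)%C *: imag_dir R (rI j)) - Phi (imag_point x) -
      (u%:C)%C * d j) <= eps) ->
  normc (Phi (imag_point y) - Phi (imag_point (fun=> 1)) - \sum_j ((y j - 1)%:C)%C * d j)
    <= eps *+ s.
Proof.
move=> al1 be1 hy step.
(* The m-th corner of the path: the first m coordinates have been moved. *)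
pose ym (m : nat) (i : 'I_s) := if (i < m)%N then y i else 1.
have ymb m i : al <= ym m i <= be by rewrite /ym; case: ifP => _ //; rewrite al1.
suff HS m : (m <= s)%N ->
    normc (Phi (imag_point (ym m)) - Phi (imag_point (fun=> 1)) - \sum_(j < s | (j <
      m)%N) ((y j - 1)%:C)%C * d j) <= eps *+ m.
  have := HS s (leqnn s); have -> : ym s = y by apply/funext => i; rewrite /ym ltn_ord.
  by under eq_bigl do rewrite ltn_ord.
elim: m => [|m IH] ms.
  rewrite big_pred0 // subr0 (_ : ym 0%N = fun=> 1) // subrr normc0 //.
pose jm := Ordinal ms.
rewrite (bigD1 jm) //= (eq_bigl (fun j : 'I_s => (j < m)%N)); last first.
  by move=> j; rewrite ltnS -val_eqE /= andbC -ltn_neqAle.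
have E : imag_point (ym m.+1) = imag_point (ym m) + ((y jm - 1)%:C)%C *: imag_dir R (rI jm).
  rewrite imag_point_shift; congr imag_point; apply/funext => i; rewrite /ym ltnS leq_eqVlt.
  case: (eqVneq i jm) => [->|hne] /=; first by rewrite eqxx ltnn addrC subrK.
  by rewrite -val_eqE /= in hne; rewrite (negbTE hne) addr0.
have st : normc (Phi (imag_point (ym m.+1)) - Phi (imag_point (ym m)) - ((y jm - 1)%:C)%C
  * d jm) <= eps.
  rewrite E; apply: step; first exact: ymb.
  by rewrite /ym ltnn addrC subrK.
have := lerD (IH (ltnW ms)) st; rewrite -mulrSr; apply: le_trans.
apply: le_trans (le_normcD _ _); rewrite le_eqVlt; apply/orP; left; apply/eqP; congr normc.
move: (Phi _) (Phi _) (Phi _) (\sum_(j < s | _) _) (_ * d jm) => p q r x z; ring.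
Qed.

Lemma fin_bound (I : finType) (P : I -> R -> Prop) :
  (forall i K K', P i K -> K <= K' -> P i K') -> (forall i, exists K, P i K) ->
  exists K, 0 <= K /\ forall i, P i K.
Proof.
move=> mono /choice[K hK]; exists (\sum_i `|K i|); split; first exact: sumr_ge0.
move=> i; apply: mono (hK i) _; apply: le_trans (ler_norm _) _.
by rewrite (bigD1 i) //= lerDl sumr_ge0.
Qed.

Lemma decays_fin (I : finType) (F : I -> V -> C) (al be : R) : 0 < al ->
  (forall i, decays (F i)) -> exists K, 0 <= K /\
    forall i m, bounded_on (imbox al be) (torus_avg m (torus_dirs R s t) (F i)) (K /
      m.+1%:R).
Proof.
move=> al0 dF; apply: fin_bound => [i K K' hK KK' m z zS|i]; last exact: dF.
by apply: le_trans (hK m z zS) _; rewrite ler_wpM2r // invr_ge0 ler0n.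
Qed.

Local Notation dirs := (torus_dirs R s t).
Local Notation G k := (rderive (imag_dir R (rI k)) (h A A)).

Lemma upd_between (x : 'I_s -> R) j (u w al be : R) :
  (forall i, al <= x i <= be) -> al <= x j + u <= be ->
  0 <= w <= u \/ u <= w <= 0 ->
  forall i, al <= x i + (if i == j then w else 0) <= be.
Proof.
move=> hx hu hw i; have /andP[x1 x2] := hx i; case: eqP => [ij|_].
  move: x1 x2; rewrite ij => x1 x2; move/andP: hu => [u1 u2].
  by apply/andP; case: hw => /andP[w1 w2]; split; lra.
by rewrite addr0 x1.
Qed.

(** The gradient of the average is almost constant in y: the average of [drift_main] has a
    y-derivative O(1/m), and the average of [drift_rest] is itself O(1/m). *)
Lemma rderive_avg_drift (al be : R) : 0 < al -> al <= 1 -> 1 <= be -> exists K, 0 <= K /\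
  forall k m y, (forall i, al <= y i <= be) ->
  normc (torus_avg m dirs (G k) (imag_point y) - torus_avg m dirs (G k) (imag_point
    (fun=> 1))) <= K / m.+1%:R.
Proof.
move=> al0 al1 be1.
have [K1 [K10 hK1]] := decays_fin be al0 (fun p :
  'I_s * 'I_s => decays_rderive_drift_main p.1 p.2).
have [K2 [K20 hK2]] := decays_fin be al0 decays_drift_rest.
(* The cost of one leg of length at most be - al: the mean value bound for [drift_main], and the
   values of [drift_rest] at both ends. *)
pose K0 := normc (- 'i * 2 : C) * (2 * K1 * (be - al)) + (K2 + K2).
have bal : 0 <= be - al by lra.
have K00 : 0 <= K0 by rewrite addr_ge0 ?addr_ge0 ?mulr_ge0 ?normc_ge0.
exists (K0 *+ s); split; first exact: mulrn_wge0.
move=> k m y hy; have := @axis_path (torus_avg m dirs (G k)) (fun=> 0) al be (K0 /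
  m.+1%:R) y al1 be1 hy.
rewrite big1 ?subr0; last by move=> j _; rewrite mulr0.
rewrite -mulrnAl; apply => x j u hx hu; rewrite mulr0 subr0.
have E : G k = fun z => (- 'i * 2) * drift_main k z + 1 * drift_rest k z.
  by apply/funext => z; exact: rderive_drift_split.
rewrite E torus_avg_lincomb.
have zx : imbox al be (imag_point x) by exact: imag_point_imbox.
have between (w : R) : 0 <= w <= u \/ u <= w <= 0 ->
  imbox al be (imag_point x + (w%:C)%C *: imag_dir R (rI j)).
  by move=> hw; rewrite imag_point_shift; apply: imag_point_imbox;
    exact: upd_between hx hu hw.
have zu : imbox al be (imag_point x + (u%:C)%C *: imag_dir R (rI j)).
  by apply: between; case: (lerP 0 u) => u0; [left|right; rewrite (ltW u0)]; rewrite lexx.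
have stab v : v \in dirs -> translation_stable (imbox al be) v by exact: stable_torus_dirs.
have dP z : imbox al be z -> has_rderive (torus_avg m dirs (drift_main k)) z (imag_dir R
  (rI j)) (torus_avg m dirs (rderive (imag_dir R (rI j)) (drift_main k)) z).
  move=> zS; apply: (torus_avg_rderive m stab _ zS) => {zS}z /(imbox_sub al0) Oz;
    apply: rderivableP.
  exact: smooth_on_rderivable (nice_smooth (nice_drift_main k)) Oz.
have B1 : normc (torus_avg m dirs (drift_main k) (imag_point x + (u%:C)%C *: imag_dir R
  (rI j)) - torus_avg m dirs (drift_main k) (imag_point x))
  <= 2 * (K1 / m.+1%:R) * (be - al).
  have := @mean_value _ _ (torus_avg m dirs (drift_main k)) (imag_point x) (imag_dir R
    (rI j)) u 0 (K1 / m.+1%:R).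
  rewrite mulr0 subr0 => h1; apply: le_trans (h1 _ _) _.
  - by move=> w /between /dP /has_rderivableE[].
  - move=> w /between hw; have [_ ->] := has_rderivableE (dP _ hw).
    by rewrite subr0; exact: (hK1 (j, k)).
  - rewrite ler_wpM2l ?mulr_ge0 ?invr_ge0 ?ler0n //.
    by have /andP[? ?] := hx j; move/andP: hu => [? ?]; rewrite ler_norml; apply/andP;
      split; lra.
have B2 : normc (torus_avg m dirs (drift_rest k) (imag_point x + (u%:C)%C *: imag_dir R
  (rI j)) - torus_avg m dirs (drift_rest k) (imag_point x)) <= (K2 + K2) / m.+1%:R.
  by rewrite mulrDl; apply: le_trans (le_normcD _ _) (lerD _ _); rewrite ?normcN;
    exact: hK2.
set P1 := torus_avg _ _ _ _ in B1 *;
  set P2 := torus_avg _ _ (drift_main k) (imag_point x) in B1 *.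
set Q1 := torus_avg _ _ _ _ in B2 *;
  set Q2 := torus_avg _ _ (drift_rest k) (imag_point x) in B2 *.
rewrite (_ : _ - _ = (- 'i * 2) * (P1 - P2) + (Q1 - Q2)); last first.
  by move: P1 P2 Q1 Q2 {B1 B2} => p1 p2 q1 q2; ring.
apply: le_trans (le_normcD _ _) _;
  rewrite /K0 mulrDl lerD // normcM -mulrA ler_wpM2l ?normc_ge0 //.
by apply: le_trans B1 _; rewrite -mulrA [_ / _ * _]mulrAC !mulrA.
Qed.

(** A second integration: with a gradient within O(1/m) of its value at y = 1, the mean value
    inequality along axis paths makes the average affine up to O(1/m). *)
Lemma affine_average (al be : R) : 0 < al -> al <= 1 -> 1 <= be -> exists K,
  forall m y, (forall i, al <= y i <= be) ->
  normc (torus_avg m dirs (h A A) (imag_point y) - torus_avg m dirs (h A A) (imag_point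
    (fun=> 1)) -
   \sum_j ((y j - 1)%:C)%C * torus_avg m dirs (G j) (imag_point (fun=> 1))) <= K / m.+1%:R.
Proof.
move=> al0 al1 be1; have [K [K0 hK]] := rderive_avg_drift al0 al1 be1.
exists ((2 * K * (be - al)) *+ s) => m y hy.
have := @axis_path (torus_avg m dirs (h A A)) (fun j => torus_avg m dirs (G j)
  (imag_point (fun=> 1))) al be (2 * (K / m.+1%:R) * (be - al)) y al1 be1 hy.
have -> : 2 * (K / m.+1%:R) * (be - al) *+ s = (2 * K * (be - al)) *+ s / m.+1%:R.
  by rewrite [RHS]mulrnAl; congr (_ *+ s); move: (m.+1%:R^-1) => q; ring.
apply => x j u hx hu.
have between (w : R) : 0 <= w <= u \/ u <= w <= 0 ->
  forall i, al <= x i + (if i == j then w else 0) <= be.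
  by move=> hw; exact: upd_between hx hu hw.
have stab v : v \in dirs -> translation_stable (imbox al be) v by exact: stable_torus_dirs.
have dP z : imbox al be z -> has_rderive (torus_avg m dirs (h A A)) z (imag_dir R (rI j))
  (torus_avg m dirs (G j) z).
  move=> zS; apply: (torus_avg_rderive m stab _ zS) => {zS}z /(imbox_sub al0) Oz;
    apply: rderivableP.
  exact: smooth_on_rderivable (nice_smooth (nice_H A A)) Oz.
apply: le_trans (mean_value (B := K / m.+1%:R) _ _) _.
- by move=> w /between hw; rewrite imag_point_shift;
  have [] := has_rderivableE (dP _ (imag_point_imbox hw)).
- move=> w /between hw; rewrite imag_point_shift;
  have [_ ->] := has_rderivableE (dP _ (imag_point_imbox hw)).
  exact: hK.
- rewrite ler_wpM2l ?mulr_ge0 ?invr_ge0 ?ler0n //.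
  by have /andP[? ?] := hx j; move/andP: hu => [? ?]; rewrite ler_norml; apply/andP;
    split; lra.
Qed.

Lemma line_avg_between (S : set V) m v f (lo hi : R) : translation_stable S v ->
  (forall z, S z -> lo <= complex.Re (f z) <= hi) ->
  forall z, S z -> lo <= complex.Re (line_avg m v f z) <= hi.
Proof.
move=> st hf z Sz; rewrite /line_avg Re_realM.
have -> (n : nat) (F : 'I_n -> C) : complex.Re (\sum_(i < n) F i)
  = \sum_(i < n) complex.Re (F i).
  by elim/big_ind2: _ => // ? ? ? ? <- <-; rewrite Re_add.
have N0 : 0 < (m.+1 ^ 2)%:R :> R by rewrite ltr0n expn_gt0.
have cE (c : R) : c *+ (m.+1 ^ 2) = \sum_(i < m.+1 ^ 2) c by rewrite sumr_const card_ord.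
rewrite ler_pdivlMl // ler_pdivrMl // !mulr_natl !cE.
by apply/andP; split; apply: ler_sum => i _;
  have /andP[] := hf _ (st _ (i%:R / m.+1%:R) Sz).
Qed.

Lemma torus_avg_between (S : set V) m (r : seq V) f (lo hi : R) : (forall v, v \in r ->
  translation_stable S v) ->
  (forall z, S z -> lo <= complex.Re (f z) <= hi) ->
  forall z, S z -> lo <= complex.Re (torus_avg m r f z) <= hi.
Proof.
elim: r => //= v r IH st hf; apply: line_avg_between; first exact/st/mem_head.
by apply: IH => // w wr; apply: st; rewrite inE wr orbT.
Qed.

Lemma Re_le_mean_diff (x w : C) (e : R) : normc (x - w) <= e ->
  complex.Re w - e <= complex.Re x <= complex.Re w + e.
Proof.
move=> hx; have := le_trans (Re_le_normc _) hx;
  rewrite Re_add Re_opp ler_norml => /andP[? ?].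
by apply/andP; split; lra.
Qed.

(* The limit is taken along a cluster point of the coefficients, so that all y are
   treated with the same coefficients. *)
Lemma affine_limit : exists c0 : R, exists c : 'I_s -> R,
  forall y, (forall j, 0 < y j) -> forall lo hi,
  (forall z, (forall j, complex.Im (z 0 (rI j)) = y j) ->
    lo <= complex.Re (H z A A) <= hi) ->
  lo <= c0 + \sum_j (y j - 1) * c j <= hi.
Proof.
pose F0 m := complex.Re (torus_avg m dirs (h A A) (imag_point (fun=> 1))).
pose G0 m j := complex.Re (torus_avg m dirs (G j) (imag_point (fun=> 1))).
have stab (al be : R) v : v \in dirs ->
  translation_stable (imbox al be) v by exact: stable_torus_dirs.
have y1 : imbox 1 1 (imag_point (fun=> 1)) by apply: imag_point_imbox => j; rewrite lexx.
(* Value and gradient at y = 1 form one vector of R^(s+1), so that a single cluster point serves all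
   coefficients. *)
pose x m : 'rV[R]_(s.+1) := \row_(i < s.+1) (if unlift ord0 i is Some j then G0 m j else
  F0 m).
have [B hB] : exists B, forall m i, `|x m ord0 i| <= B.
  have [B0 hB0] := nice_bounded 1 (nice_H A A) (ltr01 : 0 < 1 :> R).
  have nG j : nice (G j) := nice_rderive _ (nice_H A A).
  have [B1 [B10 hB1]] : exists K, 0 <= K /\ forall j, bounded_on (imbox 1 1) (G j) K.
    apply: fin_bound => [i K K' hK KK' z zS|i];
      last exact: (nice_bounded 1 (nG i) (ltr01 : 0 < 1 :> R)).
    exact: le_trans (hK z zS) KK'.
  exists (Num.max B0 B1) => m i; rewrite mxE le_max; case: unliftP => [j _|_].
    apply/orP; right; apply: le_trans (Re_le_normc _) _.
    exact: (torus_avg_bounded m (@stab 1 1) (hB1 j) y1).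
  apply/orP; left; apply: le_trans (Re_le_normc _) _.
  exact: (torus_avg_bounded m (@stab 1 1) hB0 y1).
have cK : compact [set v : 'rV[R]_(s.+1) | forall i, v ord0 i \in `[(- B), B]].
  by apply: (@rV_compact _ _ (fun=> `[(- B), B]%classic)) => _; apply: segment_compact.
have [p [_ clp]] : [set v : 'rV[R]_(s.+1) | forall i, v ord0 i \in `[(- B),
  B]] `&` cluster (x @ \oo) !=set0.
  apply: cK; exists 0%N => // m _ i; rewrite in_itv /= -ler_norml.
  exact: (hB m i).
have close (e : R) N : 0 < e -> exists2 m, (N <= m)%N & forall i,
  `|x m ord0 i - p ord0 i| < e.
  move=> e0; have := clp [set v | exists2 m, (N <= m)%N & v = x m] (ball p e).
  case.
  - by exists N => // m Nm; exists m.
  - exact: nbhsx_ballx.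
  move=> v [[m Nm ->] /= [_ bm]]; exists m => // i; rewrite distrC; exact: bm.
exists (p ord0 ord0), (fun j => p ord0 (lift ord0 j)) => y y0 lo hi hf.
have [al [be [al0 al1 be1 hy]]] : exists al be : R, [/\ 0 < al, al <= 1, 1 <= be &
    forall i, al <= y i <= be].
  exists (\big[Num.min/1]_j y j), (\big[Num.max/1]_j y j); split.
  - by apply/lt_bigmin.
  - exact: bigmin_le_id.
  - exact: bigmax_ge_id.
  - by move=> i; rewrite bigmin_le_cond // le_bigmax_cond.
have [K hK] := affine_average al0 al1 be1.
(* The total weight of the s+1 coefficients in the affine expression at y: an error e/2/W in each of
   them costs at most e/2. *)
pose W := 1 + \sum_j `|y j - 1|.
have W0 : 0 < W by rewrite ltr_pwDl // sumr_ge0.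
have main e : 0 < e -> lo - e <= p ord0 ord0 + \sum_j (y j - 1) * p ord0 (lift ord0 j)
  <= hi + e.
  move=> e0.
  have e20 : 0 < e / 2 by rewrite divr_gt0.
  have [N hN] : exists N : nat, `|K| / N.+1%:R <= e / 2.
    have := archi_boundP (ltW (divr_gt0 (ltr_pwDl ltr01 (normr_ge0 K)) e20)).
    set N := Num.bound _ => hN; exists N.
    rewrite ler_pdivrMr ?ltr0n // mulrC -ler_pdivrMr //.
    apply: le_trans (ltW (lt_trans hN _)); last by rewrite ltr_nat.
    by rewrite ler_wpM2r // ?invr_ge0 ?(ltW e20) // lerDr.
  have [m Nm hm] := close (e / 2 / W) N (divr_gt0 e20 W0).
  have hKm : K / m.+1%:R <= e / 2.
    apply: le_trans hN; apply: (@le_trans _ _ (`|K| / m.+1%:R)).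
      by rewrite ler_wpM2r ?invr_ge0 ?ler0n // ler_norm.
    by rewrite ler_wpM2l // lef_pV2 ?posrE ?ltr0n // ler_nat.
  have := le_trans (hK m y hy) hKm.
  have -> : forall X Y Z : C, normc (X - Y - Z) = normc (X - (Y + Z)) by move=> X Y Z;
    rewrite opprD addrA.
  move=> /Re_le_mean_diff /andP[]; rewrite Re_add.
  have -> : complex.Re (\sum_j (y j - 1)%:C%C * torus_avg m dirs (G j) (imag_point (fun=>
    1))) = \sum_j (y j - 1) * G0 m j.
    by elim/big_ind2: _ => // [? ? ? ? <- <-|j _]; rewrite ?Re_add ?Re_realM.
  rewrite -/(F0 m).
  (* The slice Im z = y is itself stable under the torus directions, so bounds on it pass to the
     averages. *)
  have /andP[] : lo <= complex.Re (torus_avg m dirs (h A A) (imag_point y)) <= hi.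
    apply: (@torus_avg_between (fun z => forall j, complex.Im (z 0 (rI j)) = y j)) => //.
      by move=> v vd z u zS j; rewrite !mxE Im_add Im_realM (torus_dirs_Im _ vd) mulr0
        addr0.
    by move=> j; rewrite imag_point_real.
  have : `|(p ord0 ord0 + \sum_j (y j - 1) * p ord0 (lift ord0 j)) - (F0 m + \sum_j (y j
    - 1) * G0 m j)| <= e / 2.
    have -> : e / 2 = e / 2 / W + \sum_j `|y j - 1| * (e / 2 / W).
      have eW : e / 2 / W * W = e / 2 by rewrite divfK ?gt_eqF.
      by rewrite -mulr_suml -[LHS]eW [LHS]mulrC {1}/W mulrDl mul1r.
    rewrite opprD addrACA -sumrB; apply: le_trans (ler_normD _ _) _; apply: lerD.
      by have := hm ord0; rewrite mxE unlift_none distrC => /ltW.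
    apply: le_trans (ler_norm_sum _ _ _) _; apply: ler_sum => j _.
    rewrite -mulrBr normrM ler_wpM2l //.
    by have := hm (lift ord0 j); rewrite mxE liftK distrC => /ltW.
  rewrite ler_norml => /andP[? ?] ? ? ? ?; apply/andP; split; lra.
apply/andP; split.
  by apply/ler_addgt0Pr => e /main /andP[]; rewrite lerBlDr.
by apply/ler_addgt0Pr => e /main /andP[].
Unshelve. all: by end_near. Qed.

End PluriclosedAverage.

(** * Embeddings of the number field *)

Section Embeddings.
Variable R : realType.
Local Notation C := (Cx R).
Variables (s t : nat) (K : fieldExtType rat).
Variable sigma : 'I_(s + t + t) -> {rmorphism K -> C}.
Hypothesis hsigma : embedding_labelling sigma.
Implicit Types (x u : K) (q : {poly rat}).
Local Notation m := (s + t + t)%N.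
Local Notation alg := (in_alg K).
Local Notation pK := (map_poly alg).
Local Notation pC := (map_poly (ratr : rat -> C)).

Lemma emb_alg (f : {rmorphism K -> C}) (r : rat) : f (r%:A) = ratr r.
Proof. exact: (fmorph_eq_rat (f \o alg) r). Qed.

Lemma emb_poly (f : {rmorphism K -> C}) q x : f (pK q).[x] = (pC q).[f x].
Proof.
rewrite -horner_map -map_poly_comp; congr (_.[_]).
by apply: eq_map_poly => r /=; rewrite emb_alg.
Qed.

Lemma primitive_element : exists th : K, exists p : {poly rat},
  [/\ pK p = minPoly 1%VS th, forall x, exists2 q : {poly rat},
    (size q < size p)%N & x = (pK q).[th] &
      forall q, (pK q).[th] = 0 -> p %| q].
Proof.
have ch : [pchar K] =i pred0 by move=> x; rewrite (pchar_lalg K) pchar_num.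
have sep : separable 1%VS {:K} by apply/separableP => x _; apply: pcharf0_separable.
have gen := eq_adjoin_separable_generator sep (sub1v _).
set th := separable_generator _ _ in gen; exists th.
have /polyOver1P[p pE] := minPolyOver 1%VS th; exists p; split=> //.
  move=> x; have xth : x \in <<1; th>>%VS by rewrite -gen memvf.
  have /polyOver1P[q qE] := Fadjoin_polyOver 1%VS th x; exists q.
    have := size_Fadjoin_poly 1%VS th x; rewrite qE size_map_poly.
    by rewrite -ltnS -size_minPoly pE size_map_poly.
  by rewrite -qE Fadjoin_poly_eq.
move=> q q0; rewrite -(dvdp_map alg) -pE; apply: minPoly_dvdp; last exact/rootP.
by apply/polyOver1P; exists q.
Qed.

Lemma vanish_eval (p q : {poly rat}) (r : C) : p %| q -> (pC p).[r] = 0 -> (pC q).[r] = 0.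
Proof. by move=> /dvdpP[d ->] pr; rewrite rmorphM hornerM pr mulr0. Qed.

(** K is Q[X]/(p), so evaluation at a root r of p does not depend on the polynomial chosen to
    represent an element. *)
Lemma embedding_of_root (th : K) (p : {poly rat}) (r : C) :
  (forall x, exists2 q : {poly rat}, (size q < size p)%N & x = (pK q).[th]) ->
  (forall q, (pK q).[th] = 0 -> p %| q) -> (pC p).[r] = 0 ->
  exists f : {rmorphism K -> C}, f th = r.
Proof.
move=> gen div pr.
pose P x := sval (cid2 (gen x)).
have PE x : (pK (P x)).[th] = x by rewrite /P; case: (cid2 _).
have key q1 q2 : (pK q1).[th] = (pK q2).[th] -> (pC q1).[r] = (pC q2).[r].
  move=> e; apply/eqP; rewrite -subr_eq0 -hornerN -hornerD -rmorphN -rmorphD; apply/eqP.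
  apply: (vanish_eval _ pr); apply: div.
  by rewrite rmorphD rmorphN hornerD hornerN e subrr.
pose f x : C := (pC (P x)).[r].
have fE x q : x = (pK q).[th] -> f x = (pC q).[r].
  by move=> e; apply: key; rewrite PE.
have fB : zmod_morphism f.
  move=> x y; rewrite (fE (x - y) (P x - P y)) ?rmorphB ?hornerD ?hornerN //.
  by rewrite !PE.
have fM : monoid_morphism f.
  split; first by rewrite (fE 1 1) ?rmorph1 ?hornerC.
  move=> x y; rewrite (fE (x * y) (P x * P y)) ?rmorphM ?hornerM //.
  by rewrite !PE.
pose fA := GRing.isZmodMorphism.Build K C f fB.
pose fMm := GRing.isMonoidMorphism.Build K C f fM.
exists (HB.pack_for {rmorphism K -> C} f fA fMm).
by rewrite /= (fE th 'X) ?map_polyX ?hornerX.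
Qed.

(** The degree of K is counted by embeddings: the [sigma i th] are exactly the roots of the minimal
    polynomial of [th], which is separable. *)
Lemma primitive_labelling : exists th : K, exists p : {poly rat},
  [/\ size p = m.+1, forall x, exists2 q : {poly rat},
    (size q < size p)%N & x = (pK q).[th] &
      injective (fun i => sigma i th)].
Proof.
have [th [p [pE gen div]]] := primitive_element; exists th, p.
have inj : injective (fun i => sigma i th).
  move=> i j /= e; case: hsigma => + _ _ _ _; apply=> x.
  by have [q _ ->] := gen x; rewrite !emb_poly e.
split=> //.
have ch : [pchar K] =i pred0 by move=> x; rewrite (pchar_lalg K) pchar_num.
have [rs rsE] := closed_field_poly_normal (pC p).
have p0 : p != 0.
  rewrite -(map_poly_eq0 alg) pE; exact/monic_neq0/monic_minPoly.
have lc0 : lead_coef (pC p) != 0 by rewrite lead_coef_eq0 map_poly_eq0.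
have urs : uniq rs.
  have := pcharf0_separable 1%VS ch th; rewrite /separable_element -pE separable_map => sp.
  have : separable_poly (pC p) by rewrite separable_map.
  by rewrite rsE (eqp_separable (eqp_scale _ lc0)) separable_prod_XsubC.
have rootE r : (r \in rs) = ((pC p).[r] == 0).
  rewrite rsE hornerZ mulf_eq0 (negbTE lc0) /= -root_prod_XsubC //.
have mem r : (r \in [seq sigma i th | i <- enum 'I_m]) = (r \in rs).
  apply/mapP/idP => [[i _ ->]|].
    by rewrite rootE -emb_poly pE minPolyxx rmorph0.
  rewrite rootE => /eqP /(embedding_of_root gen div)[f fth].
  by case: hsigma => _ /(_ f)[i fi] _ _ _; exists i; rewrite ?mem_enum // -fi.
have := perm_size (uniq_perm _ urs mem).
rewrite size_map size_enum_ord => -> //; last by rewrite map_inj_uniq ?enum_uniq.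
by rewrite -(size_map_poly (ratr : {rmorphism rat -> C})) rsE size_scale // size_prod_XsubC.
Qed.

(** Multiplication by u has a rational matrix in the basis of powers of [th], and the Vandermonde
    matrix of the conjugates of [th] diagonalises it. *)
Lemma charpoly_embeddings u : exists2 chi : {poly rat}, chi \is monic &
  pC chi = \prod_i ('X - (sigma i u)%:P).
Proof.
have [th [p [szp gen inj]]] := primitive_labelling.
have /choice[q hq] k : exists q : {poly rat}, (size q <= m)%N /\ u * th ^+ k = (pK q).[th].
  by have [q] := gen (u * th ^+ k); rewrite szp ltnS => ? ?; exists q.
(* Column k holds the coordinates of u th^k. *)
pose N : 'M[rat]_m := \matrix_(l < m, k < m) (q k)`_l.
exists (char_poly N); first exact: char_poly_monic.
pose W : 'M[C]_m := \matrix_(i < m, k < m) (sigma i th) ^+ k.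
pose D : 'M[C]_m := diag_mx (\row_i sigma i u).
have W0 : \det W != 0.
  have -> : W = (Vandermonde m (\row_(i < m) sigma i th))^T by apply/matrixP => i k;
    rewrite !mxE.
  rewrite det_tr det_Vandermonde; apply/prodf_neq0 => i _; apply/prodf_neq0 => j ij.
  rewrite !mxE subr_eq0; apply/negP => /eqP /inj e; by rewrite e ltnn in ij.
have DW : D *m W = W *m map_mx (ratr : rat -> C) N.
  apply/matrixP => i k; rewrite mul_diag_mx !mxE.
  have [szq uq] := hq k.
  rewrite -rmorphXn -rmorphM uq emb_poly (horner_coef_wide _ (n := m));
    last by rewrite size_map_poly.
  by apply: eq_bigr => l _; rewrite !mxE coef_map mulrC.
rewrite map_char_poly.
have -> : char_poly (map_mx (ratr : rat -> C) N) = char_poly D.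
  have W'0 : \det (map_mx (polyC : C -> {poly C}) W) != 0 by rewrite det_map_mx polyC_eq0.
  apply: (mulfI W'0); rewrite /char_poly -det_mulmx [RHS]mulrC -det_mulmx; congr (\det _).
  by rewrite /char_poly_mx mulmxBr mulmxBl -!map_mxM -DW scalar_mxC.
rewrite char_poly_trig ?diag_mx_is_trig //.
by apply: eq_bigr => i _; rewrite !mxE eqxx.
Qed.

Lemma prod_embeddings_rat u : exists r : rat, \prod_i sigma i u = ratr r.
Proof.
have [chi _ chiE] := charpoly_embeddings u; exists ((-1) ^+ m * chi.[0]).
rewrite rmorphM rmorphXn rmorphN1 -horner_map rmorph0 chiE horner_prod.
have -> : (-1 : C) ^+ m = \prod_(i < m) -1 by rewrite prodr_const card_ord.
rewrite -big_split /=; apply: eq_bigr => i _.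
by rewrite hornerXsubC sub0r mulN1r opprK.
Qed.

Lemma integral_rat_int (r : rat) : integralOver (intr : int -> rat) r -> r \is a Num.int.
Proof.
case=> p mp rp.
have ra : (ratr r : algC) \in Aint.
  apply: (@root_monic_Aint (map_poly intr p)).
  - have -> : map_poly intr p = map_poly (ratr : rat -> algC) (map_poly intr p).
      by rewrite -map_poly_comp; apply: eq_map_poly => z /=; rewrite rmorph_int.
    by rewrite fmorph_root.
  - by rewrite monic_map.
  - by apply/polyOverP => i; rewrite coef_map /= intr_int.
have /intrP[z rz] := Cint_rat_Aint (Crat_rat r) ra.
apply/intrP; exists z; apply: (fmorph_inj (ratr : {rmorphism rat -> algC})).
by rewrite rmorph_int; exact: rz.
Qed.

Lemma prod_embeddings_int u : ring_of_integers u ->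
  exists z : int, \prod_i sigma i u = z%:~R.
Proof.
move=> iu; have [r rE] := prod_embeddings_rat u.
have ir : integralOver (intr : int -> C) (ratr r : C).
  rewrite -rE; elim/big_ind: _ => [|x y ix iy|i _].
  - exact: (integral1 (intr : {rmorphism int -> C})).
  - exact: (integral_mul (RtoK := (intr : {rmorphism int -> C}))).
  have [p mp rp] := integral_rmorph (sigma i) iu; exists p => //.
  rewrite -(_ : map_poly ((sigma i) \o intr) p = map_poly intr p) //.
  by apply: eq_map_poly => z /=; rewrite rmorph_int.
have : integralOver (intr : int -> rat) r.
  have [p mp rp] := ir; exists p => //.
  rewrite -(fmorph_root (ratr : {rmorphism rat -> C})) -map_poly_comp.
  rewrite (_ : map_poly _ p = map_poly intr p) //.
  by apply: eq_map_poly => z /=; rewrite rmorph_int.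
move=> /integral_rat_int /intrP[z rz]; exists z.
by rewrite rE rz rmorph_int.
Qed.

Lemma prod_embeddings_split u : \prod_i sigma i u =
  (\prod_j sigma (real_idx t j) u) * \prod_a `|sigma (cplx_idx s a) u| ^+ 2.
Proof.
rewrite big_split_ord /= big_split_ord /= -mulrA; congr (_ * _).
rewrite -big_split; apply: eq_bigr => a _ /=.
by case: hsigma => _ _ _ _ /(_ a u) h; rewrite normCK -h.
Qed.

Lemma norm_unit u : totally_positive_units sigma u ->
  (\prod_j sigma (real_idx t j) u) * \prod_a `|sigma (cplx_idx s a) u| ^+ 2 = 1.
Proof.
move=> [u0 iu iu' pos]; rewrite -prod_embeddings_split.
have [z zE] := prod_embeddings_int iu; have [z' zE'] := prod_embeddings_int iu'.
have zz : z * z' = 1.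
  apply/eqP; rewrite -(eqr_int C) rmorphM /= -zE -zE' -big_split /=.
  by rewrite big1 // => i _; rewrite -rmorphM mulfV ?rmorph1.
(* Total positivity handles the real embeddings; the others pair up into squared moduli. *)
have zpos : 0 < z.
  rewrite -(ltr0z C) -zE prod_embeddings_split; apply: mulr_gt0; apply: prodr_gt0 => i _ //.
  by rewrite exprn_gt0 // normr_gt0 fmorph_eq0.
have z'0 : 0 < z' by rewrite -(pmulr_rgt0 _ zpos) zz.
suff z1 : z = 1 by rewrite zE z1.
apply: le_anti; apply/andP; split; last by rewrite -gtz0_ge1.
by rewrite -zz ler_peMr ?(ltW zpos) // -gtz0_ge1.
Qed.

(* If |sigma_a(u)| = 1 then the conjugate of sigma_a(u) is sigma_a(u^-1), so u^-1 is a
   root of the characteristic polynomial of u. *)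
Lemma conjugate_inverse u a : u != 0 -> `|sigma (cplx_idx s a) u| = 1 ->
  forall i, exists k, sigma k u = (sigma i u)^-1.
Proof.
move=> u0 n1 i; have [chi _ chiE] := charpoly_embeddings u.
have inv : sigma (conj_idx s a) u = sigma (cplx_idx s a) u^-1.
  case: hsigma => _ _ _ _ ->; rewrite fmorphV.
  have x0 : sigma (cplx_idx s a) u != 0 by rewrite fmorph_eq0.
  by apply: (mulfI x0); rewrite -normCK n1 expr1n mulfV.
have rt k : (pC chi).[sigma k u] = 0.
  apply/rootP; rewrite chiE (bigD1 k) //= rootM root_XsubC eqxx //.
have : (pK chi).[u^-1] = 0.
  apply/eqP; rewrite -(fmorph_eq0 (sigma (cplx_idx s a))) emb_poly -inv; exact/eqP/rt.
move=> /(congr1 (sigma i)); rewrite emb_poly rmorph0 chiE horner_prod => /eqP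
  /prodf_eq0[k _].
by rewrite hornerXsubC subr_eq0 fmorphV => /eqP e; exists k.
Qed.

End Embeddings.

(** * The action of O_K x| U *)

Section Action.
Variable R : realType.
Local Notation C := (Cx R).
Variables (s t : nat) (K : fieldExtType rat).
Variable sigma : 'I_(s + t + t) -> {rmorphism K -> C}.
Variable U : set K.
Hypothesis hsigma : embedding_labelling sigma.
Hypothesis hs : (0 < s)%N.
Hypothesis U_sub : mul_subgroup U.
Hypothesis U_pos : U `<=` totally_positive_units sigma.
Local Notation V := 'rV[C]_(s + t).
Local Notation Omega := (@OT_domain R s t).
Local Notation rI := (@lshift s t).
Local Notation cI := (@rshift s t).
Implicit Types (z w : V) (u a : K) (g : K * K).

Definition sre (j : 'I_s) u : R := complex.Re (sigma (real_idx t j) u).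

Lemma sigma_real j x : sigma (real_idx t j) x = ((sre j x)%:C)%C.
Proof. by case: hsigma => _ _ h _ _; rewrite RRe_real. Qed.

Lemma sre_gt0 j u : U u -> 0 < sre j u.
Proof. by move=> /U_pos[_ _ _ /(_ j)]; rewrite sigma_real ltcR. Qed.

Lemma U_neq0 u : U u -> u != 0.
Proof. by move=> /U_pos[]. Qed.

Lemma U1 : U 1. Proof. by case: U_sub. Qed.
Lemma UM u v : U u -> U v -> U (u * v). Proof. by case: U_sub => _ h _; exact: h. Qed.
Lemma UV u : U u -> U u^-1. Proof. by case: U_sub => _ _; exact. Qed.

Lemma U_int u : U u -> ring_of_integers u.
Proof. by move=> /U_pos[]. Qed.

Lemma int_mul a b : @ring_of_integers K a -> ring_of_integers b -> ring_of_integers (a * b).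
Proof. exact: (integral_mul (RtoK := (intr : {rmorphism int -> K}))). Qed.

Lemma int_add a b : @ring_of_integers K a -> ring_of_integers b -> ring_of_integers (a + b).
Proof. exact: (integral_add (RtoK := (intr : {rmorphism int -> K}))). Qed.

Lemma int_opp a : @ring_of_integers K a -> ring_of_integers (- a).
Proof. exact: (integral_opp (RtoK := (intr : {rmorphism int -> K}))). Qed.

Lemma int_0 : @ring_of_integers K 0.
Proof. by exists 'X; [exact: monicX|rewrite map_polyX rootX]. Qed.

Lemma act_Im g z j : complex.Im ((OT_act sigma g z) 0 (rI j))
  = sre j g.2 * complex.Im (z 0 (rI j)).
Proof. by rewrite mxE Im_add -/(real_idx t j) !sigma_real Im_realM addr0. Qed.

Lemma act_comp g h z : OT_act sigma g (OT_act sigma h z) = OT_act sigma (g.2 * h.1 + g.1,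
  g.2 * h.2) z.
Proof. by apply/rowP => i; rewrite !mxE /= rmorphD !rmorphM mulrDr addrA mulrA. Qed.

Lemma act1 z : OT_act sigma (0, 1) z = z.
Proof. by apply/rowP => i; rewrite !mxE /= rmorph1 rmorph0 mul1r addr0. Qed.

Definition ginv g : K * K := (- (g.2^-1 * g.1), g.2^-1).

Lemma act_inv g z : g.2 != 0 -> OT_act sigma (ginv g) (OT_act sigma g z) = z.
Proof. by move=> u0; rewrite act_comp /= subrr mulVf // act1. Qed.

Lemma group_inv g : OT_group U g -> OT_group U (ginv g).
Proof. by case=> h1 h2; split; [apply/int_opp/int_mul => //; exact/U_int/UV|exact: UV]. Qed.

Lemma group_mul g h : OT_group U g -> OT_group U h ->
  OT_group U (g.2 * h.1 + g.1, g.2 * h.2).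
Proof. by case=> h1 h2 [h3 h4]; split; [apply/int_add/h1/int_mul => //;
  exact: U_int|exact: UM]. Qed.

Lemma group1 : OT_group U (0, 1).
Proof. by split; [exact: int_0|exact: U1]. Qed.

Lemma act_domain g z : U g.2 -> Omega z -> Omega (OT_act sigma g z).
Proof. by move=> Ug Oz j; rewrite act_Im mulr_gt0 // sre_gt0. Qed.

Lemma act_continuous g : continuous (OT_act sigma g : V -> V).
Proof.
move=> z; apply: continuous_rV => i.
rewrite /prop_for /continuous_at mxE; under eq_fun do rewrite mxE.
exact: (cvgD (cvgM (cvg_cst _) (@coord_continuous C 1 (s + t) 0 i z)) (cvg_cst _)).
Qed.

Lemma act_free g z : U g.2 -> Omega z -> OT_act sigma g z = z -> g = (0, 1).
Proof.
case: g => a u /= Uu Oz e; pose j := Ordinal hs.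
have e1 := act_Im (a, u) z j; rewrite e /= in e1.
have y0 : complex.Im (z 0 (rI j)) != 0 by rewrite gt_eqF.
have r1 : sre j u = 1 by apply: (mulIf y0); rewrite mul1r -e1.
have u1 : u = 1.
  by apply: (fmorph_inj (sigma (real_idx t j))); rewrite sigma_real r1 !rmorph1.
have : sigma (real_idx t j) a = 0.
  move/rowP: e => /(_ (rI j)); rewrite mxE -/(real_idx t j) /= u1 rmorph1 mul1r => /eqP.
  by rewrite -subr_eq0 addrAC subrr add0r => /eqP.
by move/eqP; rewrite fmorph_eq0 => /eqP ->; rewrite u1.
Qed.

Lemma orbit_act g z : OT_group U g ->
  OT_orbit sigma U (OT_act sigma g z) = OT_orbit sigma U z.
Proof.
move=> Gg; apply/seteqP; split => w [h Gh <-].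
  by exists (h.2 * g.1 + h.1, h.2 * g.2); [exact: group_mul|rewrite act_comp].
exists (h.2 * (ginv g).1 + h.1, h.2 * (ginv g).2); first exact: group_mul (group_inv Gg).
by rewrite -act_comp act_inv //; apply: U_neq0; case: Gg.
Qed.

Lemma orbit_eq z w : OT_orbit sigma U z = OT_orbit sigma U w ->
  exists2 g, OT_group U g & w = OT_act sigma g z.
Proof.
move=> e; have : OT_orbit sigma U w w by exists (0, 1); [exact: group1|exact: act1].
by rewrite -e => -[g Gg <-]; exists g.
Qed.

Lemma near_seq_forall (T : eqType) (l : seq T) (P : T -> V -> Prop) z :
  (forall x : T, x \in l -> \forall w \near z, P x w) ->
  \forall w \near z, forall x : T, x \in l -> P x w.
Proof.
elim: l => [|x l IH] hP; first by apply: filterE.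
have h1 := hP x (mem_head x l).
have h2 := IH (fun (y : T) yl => hP y (mem_behead (s := x :: l) yl)).
by apply: filterS2 h1 h2 => w Px Pl y; rewrite inE => /predU1P[->//|]; exact: Pl.
Qed.

(** * Charts of the quotient *)

Hypothesis U_pd : properly_discontinuous sigma U.

Lemma compact_nbhs z0 : Omega z0 ->
  exists B : set V, [/\ compact B, B `<=` Omega & nbhs z0 B].
Proof.
(* Half of the height keeps the box inside the upper half-planes; in the complex coordinates any
   radius will do. *)
move=> Oz; pose r (i : 'I_(s + t)) : R :=
  if fintype.split i is inl j then complex.Im (z0 0 (rI j)) / 2 else 1.
have r0 i : 0 < r i by rewrite /r; case: (fintype.split i) => // j; rewrite divr_gt0 ?Oz.
pose B : R := 1 + \sum_i `|complex.Re (z0 0 i)|.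
exists [set z : V | forall i, `|complex.Re (z 0 i)| <= B /\
   (complex.Im (z0 0 i) - r i <= complex.Im (z 0 i) <= complex.Im (z0 0 i) + r i)]; split.
- have cb := @compact_box R (s + t) B (fun i => (complex.Im (z0 0 i) - r i,
  complex.Im (z0 0 i) + r i)). exact: cb.
- move=> z hz j; have [_ /andP[+ _]] := hz (rI j).
  rewrite /r (@unsplitK s t (inl _ j)) => h; apply: lt_le_trans h.
  by have := Oz j; lra.
- apply: (@filter_forall _ _ (fun (i : 'I_(s + t)) (z : V) => `|complex.Re (z 0 i)| <= B /\
   (complex.Im (z0 0 i) - r i <= complex.Im (z 0 i)
     <= complex.Im (z0 0 i) + r i)) (nbhs z0) (nbhs_filter z0)) => i.
  have cR : {for z0, continuous (fun w : V => complex.Re (w 0 i) : R)}.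
    apply: (@continuous_comp _ _ _ (fun w : V => w 0 i : C) (fun x : C => complex.Re x :
      R)).
      exact: coord_continuous.
    exact: continuous_Re.
  have cI' : {for z0, continuous (fun w : V => complex.Im (w 0 i) : R)}.
    apply: (@continuous_comp _ _ _ (fun w : V => w 0 i : C) (fun x : C => complex.Im x :
      R)).
      exact: coord_continuous.
    exact: continuous_Im.
  have h1 := @cvgr_dist_lt _ _ _ (nbhs z0) (nbhs_filter z0) _ _ cR _ (ltr01 : 0 < 1 :> R).
  have h2 := @cvgr_dist_lt _ _ _ (nbhs z0) (nbhs_filter z0) _ _ cI' _ (r0 i).
  apply: (@filterS2 _ (nbhs z0) (nbhs_filter z0) _ _ _ _ h1 h2) => w {}h1 {}h2; split.
    have hB : `|complex.Re (z0 0 i)| + 1 <= B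
      by rewrite addrC lerD2l (bigD1 i) //= lerDl sumr_ge0.
    apply: le_trans hB; apply: le_trans (ltW (ler_ltD (lexx _) h1)).
    by rewrite distrC -lerBlDl; apply: le_trans (lerB_dist _ _).
  by move: h2; rewrite ltr_norml => /andP[? ?]; apply/andP; split; lra.
Qed.

Lemma separate_act g z0 : OT_act sigma g z0 <> z0 ->
  exists2 W : set V, nbhs z0 W & forall z, W z -> ~ W (OT_act sigma g z).
Proof.
move=> gz; have : hausdorff_space V by exact: norm_hausdorff.
rewrite open_hausdorff => /(_ z0 (OT_act sigma g z0)).
case; first by apply/eqP => /esym.
move=> [P Q] /= [/set_mem Pz /set_mem Qz] [oP oQ /eqP PQ].
exists (P `&` OT_act sigma g @^-1` Q).
  apply: filterI; first exact: (open_nbhs_nbhs (conj oP Pz)).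
  exact: (act_continuous (open_nbhs_nbhs (conj oQ Qz))).
by move=> z [_ Qg] [Pg _]; have : (P `&` Q) (OT_act sigma g z) by []; rewrite PQ.
Qed.

(** Only finitely many elements bring a point of a compact neighbourhood back into it. The
    neighbourhood is shrunk so that each of them moving [z0] maps it off itself; one fixing [z0] is
    the identity by freeness. *)
Lemma chart_exists z0 : Omega z0 -> exists W : set V,
  [/\ W z0, open W, W `<=` Omega &
   forall z w, W z -> W w -> OT_orbit sigma U z = OT_orbit sigma U w -> z = w].
Proof.
move=> Oz; have [B [cB BO nB]] := compact_nbhs Oz.
have /finite_seqP[l lE] := U_pd cB BO.
have /choice[Wg hWg] g : exists W : set V, nbhs z0 W /\
    (OT_act sigma g z0 <> z0 -> forall z, W z -> ~ W (OT_act sigma g z)).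
  have [e|ne] := pselect (OT_act sigma g z0 = z0); first by exists setT; split => //;
    exact: filterT.
  by have [W nW hW] := separate_act ne; exists W.
have nW : \forall w \near z0, forall g, g \in l -> Wg g w.
  by apply: near_seq_forall => g _; have [] := hWg g.
pose N := B `&` [set w | forall g, g \in l -> Wg g w].
have nN : nbhs z0 N by exact: filterI.
exists (interior N); split.
- exact: nN.
- exact: open_interior.
- by move=> z /interior_subset[/BO].
move=> z w /interior_subset[Bz Wz] /interior_subset[Bw Ww] /orbit_eq[g Gg wE].
have gl : g \in l.
  by have : [set` l] g by rewrite -lE; split => //; exists z; rewrite -wE.
have [e|ne] := pselect (OT_act sigma g z0 = z0).
  by case: Gg => _ Ug; rewrite wE (act_free Ug Oz e) act1.
by have [_ /(_ ne z (Wz _ gl))] := hWg g; rewrite -wE => /(_ (Ww _ gl)).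
Qed.

Lemma continuous_Im_coord z i : {for z, continuous (fun w : V => complex.Im (w 0 i) : R)}.
Proof.
apply: (@continuous_comp _ _ _ (fun w : V => w 0 i : C) (fun x : C => complex.Im x : R)).
  exact: coord_continuous.
exact: continuous_Im.
Qed.

(** * Consequences of cocompactness *)

Hypothesis U_cc : cocompact sigma U.

Lemma cocompact_bounds : exists (B : set V) (c d : R),
  [/\ compact B, B `<=` Omega, 0 < c, (forall z, Omega z ->
    exists2 g, OT_group U g & B (OT_act sigma g z)) &
      forall z, B z -> forall j, c <= complex.Im (z 0 (rI j)) <= d].
Proof.
have [B [cB BO cov]] := U_cc.
have /choice[c hc] j : exists d, 0 < d /\ forall z, B z -> d <= complex.Im (z 0 (rI j)).
  have [d d0 hd] := @compact_lower _ _ B (fun z : V => complex.Im (z 0 (rI j)) : R) cB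
    (fun z _ => @continuous_Im_coord z (rI j)) (fun z Bz => BO z Bz j).
  by exists d.
have /choice[M hM] j : exists M, forall z, B z -> `|complex.Im (z 0 (rI j))| <= M.
  exact: (@compact_bounded _ _ B (fun z : V => complex.Im (z 0 (rI j)) : R) cB
    (fun z _ => @continuous_Im_coord z (rI j))).
exists B, (\big[Num.min/1]_j c j), (\big[Num.max/1]_j M j); split => //.
  by apply/lt_bigmin => // j _; case: (hc j).
move=> z Bz j; apply/andP; split.
  by have [_ /(_ z Bz)] := hc j; apply: le_trans; exact: bigmin_le_cond.
apply: le_trans (ler_norm _) _; apply: le_trans (hM j z Bz) _; exact: le_bigmax_cond.
Qed.

(** A point of heights c/2 or 2d can only be brought into a compact set of heights in [c, d] by a
    unit multiplying them by at least 2, respectively at most 1/2. *)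
Lemma sign_pattern (P : 'I_s -> bool) :
  exists2 u, U u & forall j, if P j then 1 < sre j u else sre j u < 1.
Proof.
have [B [c [d [_ _ c0 cov hB]]]] := cocompact_bounds.
have cd : c <= d.
  have O1 : Omega (imag_point t (fun=> 1)) by move=> j; rewrite imag_point_real.
  have [g _ /hB /(_ (Ordinal hs)) /andP[h1 h2]] := cov _ O1; exact: le_trans h1 h2.
have d0 : 0 < d := lt_le_trans c0 cd.
pose y j : R := if P j then c / 2 else 2 * d.
have Oy : Omega (imag_point t y).
  by move=> j; rewrite imag_point_real /= /y; case: (P j); rewrite ?divr_gt0 ?mulr_gt0.
have [g [_ Ug] /hB h] := cov _ Oy.
exists g.2 => // j; have := h j; rewrite act_Im imag_point_real /= /y.
have r0 := sre_gt0 j Ug; case: (P j) => /andP[h1 h2].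
  have : 2 <= sre j g.2 by rewrite -(ler_pM2r (divr_gt0 c0 (ltr0n _ 2 :
    0 < 2 :> R))) mulrCA divff ?mulr1 // gt_eqF.
  by apply: lt_le_trans; rewrite ltr1n.
have : sre j g.2 <= 2^-1.
  by rewrite -(ler_pM2r (mulr_gt0 (ltr0n _ 2 : 0 < 2 :> R) d0)) (le_trans h2) // mulKf.
by move=> h12; apply: le_lt_trans h12 _; rewrite invf_lt1 // ltr1n.
Qed.

Lemma compact_seq_bigcup (T : eqType) (l : seq T) (F : T -> set V) :
  (forall x : T, x \in l -> compact (F x)) ->
    compact [set z | exists2 x : T, x \in l & F x z].
Proof.
elim: l => [|x l IH] cF.
  rewrite (_ : [set _ | _] = set0); first exact: compact0.
  by apply/seteqP; split => // z [].
rewrite (_ : [set _ | _] = F x `|` [set z | exists2 x : T, x \in l & F x z]).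
  apply: compactU; first exact/cF/mem_head.
  by apply: IH => y yl; apply: cF; rewrite inE yl orbT.
apply/seteqP; split => z /=.
  by case=> y; rewrite inE => /predU1P[->|yl] Fz; [left|right; exists y].
by case=> [Fz|[y yl Fz]]; [exists x; rewrite ?mem_head|exists y; rewrite // inE yl orbT].
Qed.

(* By proper discontinuity, only finitely many units send a point of the box to a
   point of the compact set B; hence the translations by O_K act cocompactly on the
   box. *)
Lemma OK_cocompact (al be : R) : 0 < al -> exists B : set V,
  [/\ compact B, B `<=` Omega & forall z, imbox al be z ->
    exists2 a, ring_of_integers a & B (OT_act sigma (a, 1) z)].
Proof.
move=> al0; have [B [c [d [cB BO c0 cov hB]]]] := cocompact_bounds.
(* A unit moving a height of [al, be] into [c, d] has sigma_j(u) in [c/be, d/al]; including 1 keeps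
   the base point y = 1 in [Kc]. *)
pose lo : R := Num.min 1 (c / be); pose hi : R := Num.max 1 (d / al).
have [be0|be0] := leP be 0.
  exists set0; split=> // [|z zS]; first exact: compact0.
  have /andP[h1 h2] := zS (Ordinal hs).
  by have := lt_le_trans al0 (le_trans h1 (le_trans h2 be0)); rewrite ltxx.
have lo0 : 0 < lo by rewrite lt_min ltr01 divr_gt0.
pose Y (i : 'I_(s + t)) : R * R := if fintype.split i is inl j then (lo, hi) else (0, 0).
(* On purely imaginary points (0, u) just scales the heights, so the relevant u are detected by (0,
   u) sending y = 1 to a point of this compact set. *)
pose Kc := [set z : V | forall i : 'I_(s + t),
  `|complex.Re (z 0 i)| <= 0 /\ ((Y i).1 <= complex.Im (z 0 i) <= (Y i).2)].
have cK : compact Kc by exact: compact_box.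
have KO : Kc `<=` Omega.
  move=> z hz j; have [_ /andP[+ _]] := hz (rI j).
  by rewrite /Y (@unsplitK s t (inl _ j)); apply: lt_le_trans.
have yK y : (forall j, lo <= y j <= hi) -> Kc (imag_point t y).
  move=> hy i; rewrite /Y mxE; case: (split_ordP i) => j _.
    by rewrite /= normr0 lexx; split => //; exact: hy.
  by rewrite /= normr0 !lexx.
have /finite_seqP[l lE] := U_pd cK KO.
pose F (g : K * K) := (OT_act sigma (0, g.2^-1)) @` B.
have gl g : g \in l -> U g.2.
  by move=> gl; have : [set` l] g by []; rewrite -lE => -[[]].
exists [set z | exists2 g, g \in l & F g z]; split.
- apply: compact_seq_bigcup => g _; apply: continuous_compact => //.
  by apply: continuous_subspaceT => z; exact: act_continuous.
- by move=> z [g /gl Ug [w Bw <-]]; apply: act_domain => /=; [exact: UV|exact: BO].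
move=> z zS; have [[a u] [/= ia Uu] Bg] := cov z (imbox_sub al0 zS).
(* The element (a, u) is translation by u^-1 a followed by multiplication by u. *)
exists (u^-1 * a); first by apply: int_mul => //; exact/U_int/UV.
exists (0, u).
  suff : [set` l] (0, u) by [].
  rewrite -lE; split; first by split => //; exact: int_0.
  exists (imag_point t (fun=> 1)); split; first by apply: yK => j;
    rewrite ge_min le_max !lexx.
  have -> : OT_act sigma (0, u) (imag_point t (fun=> 1)) = imag_point t (fun j => sre j u).
    apply/rowP => i; rewrite !mxE rmorph0 addr0; case: (split_ordP i) => j -> /=.
      by rewrite -/(real_idx t j) sigma_real; apply/eqP; rewrite eq_complex /=;
        apply/andP; split; apply/eqP; ring.
    by rewrite mulr0.
  apply: yK => j; have /andP[h1 h2] := hB _ Bg j; have /andP[h3 h4] := zS j.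
  rewrite act_Im /= in h1 h2; have r0 := sre_gt0 j Uu.
  rewrite ge_min le_max ler_pdivrMr // ler_pdivlMr //.
  by apply/andP; split; apply/orP; right; [apply: le_trans h1 _|apply: le_trans h2];
    rewrite ler_pM2l.
exists (OT_act sigma (a, u) z) => //.
by rewrite act_comp /= mulVf ?U_neq0 // addr0.
Qed.

Lemma jacobian_near_act g z (phi : V ->
  V) : (\forall w \near z, phi w = OT_act sigma g w) ->
  jacobian phi z = diag_mx (\row_i sigma (lshift t i) g.2).
Proof.
move=> hphi; set D := diag_mx _.
pose L : {linear V -> V} := mulmxr D.
have LE (w : V) i : (L w) 0 i = w 0 i * sigma (lshift t i) g.2.
  by rewrite /L /= mul_mx_diag !mxE.
have Lc : continuous (L : V -> V).
  move=> w; apply: continuous_rV => i; rewrite /prop_for /continuous_at LE.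
  under eq_fun do rewrite LE.
  exact: (cvgM (@coord_continuous C 1 (s + t) 0 i w) (cvg_cst _)).
have dphi : 'd phi z = L :> (V -> V).
  apply: diff_unique => //; apply/eqaddoP => e e0.
  have : \forall h \near (0 : V), phi (h + z) = OT_act sigma g (h + z).
    have := hphi; rewrite (near_shift (0 : V) z) /= => H0.
    by apply: filterS H0 => h /=; rewrite subr0.
  apply: filterS => h hE; rewrite /= [X in `|X|](_ : _ = 0) ?normr0 ?mulr_ge0 ?(ltW e0) //.
  rewrite -[LHS]/(phi (h + z) - (phi z + L h)) hE (nbhs_singleton hphi).
  have -> : OT_act sigma g (h + z) = OT_act sigma g z + L h.
    apply/rowP => i; rewrite [RHS]mxE LE !mxE.
    by move: (sigma _ g.2) (sigma _ g.1) (h 0 i) (z 0 i) => x x' y y'; ring.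
  exact: subrr.
rewrite /jacobian; apply/matrixP => i j; rewrite mxE dphi LE !mxE.
by rewrite eqxx /= eq_sym; case: eqP => [->|_]; rewrite ?mul1r ?mul0r.
Qed.

(** * Squared moduli and the explicit pluriclosed metric *)

Definition cnorm2 (a : 'I_t) u : R := normc (sigma (cplx_idx s a) u) ^+ 2.

Lemma cnorm2M (a : 'I_t) u (v : K) : cnorm2 a (u * v) = cnorm2 a u * cnorm2 a v.
Proof. by rewrite /cnorm2 rmorphM normcM exprMn. Qed.

Lemma cnorm2_gt0 (a : 'I_t) u : u != 0 -> 0 < cnorm2 a u.
Proof.
move=> u0; rewrite exprn_gt0 // lt_neqAle normc_ge0 andbT eq_sym.
apply/eqP => /eq0_normc/eqP; by rewrite fmorph_eq0 (negbTE u0).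
Qed.

Lemma cnorm2E (a : 'I_t) u : `|sigma (cplx_idx s a) u| ^+ 2 = ((cnorm2 a u)%:C)%C.
Proof. by rewrite normCxE -rmorphXn. Qed.

(* A family of functions of y = Im z_j, closed under derivation, which contains
   both y and y^-2. *)
Definition power_fun (a b w : R) (k : nat) (j : 'I_s) : V -> C := fun z =>
  let y := complex.Im (z 0 (rI j)) in ((a + b * y + w * y^-1 ^+ k)%:C)%C.

Lemma is_derive_power_fun (a b w : R) k (y x : R) : 0 < y ->
  is_derive (0 : R) 1 (fun u : R => a + b * (y + u * x) + w * (y + u * x)^-1 ^+ k)
    (b * x + - (k%:R * w * x) * y^-1 ^+ k.+1).
Proof.
move=> y0; have yn : y != 0 by rewrite gt_eqF.
pose g (u : R) : R := y + u * x.
have g0 : g 0 = y by rewrite /g mul0r addr0.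
have d1 : is_derive (0 : R) 1 g x.
  have e : g = cst y + x \*: (id : R -> R) by apply/funext => u; rewrite /g mulrC.
  rewrite e; have := is_deriveD (is_derive_cst y (0 : R) (1 :
    R)) (is_deriveZ x (is_derive_id (0 : R) (1 : R))).
  by rewrite add0r [x *: 1]mulr1.
have gn : g 0 != 0 by rewrite g0.
have d2 : is_derive (0 : R) 1 (fun u : R => (g u)^-1) (- y ^- 2 * x).
  split; first exact: (derivableV gn (@ex_derive _ _ _ _ _ _ _ d1)).
  by rewrite (deriveV gn (@ex_derive _ _ _ _ _ _ _ d1)) (@derive_val _ _ _ _ _ _ _ d1) g0.
have d3 := is_deriveX k d2; rewrite g0 in d3.
have := is_deriveD (is_deriveD (is_derive_cst a (0 : R) (1 :
  R)) (is_deriveZ b d1)) (is_deriveZ w d3).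
have -> : cst a + b \*: g + w \*: (fun u : R => (g u)^-1) ^+ k =
    (fun u : R => a + b * (y + u * x) + w * (y + u * x)^-1 ^+ k).
  by apply/funext => u; rewrite /= exprfctE.
have -> : 0 + b *: x + w *: (k%:R * y^-1 ^+ k.-1 *: (- y ^- 2 * x)) =
    b * x + - (k%:R * w * x) * y^-1 ^+ k.+1; last by [].
rewrite add0r; congr (_ + _); rewrite -!/(_ * _).
case: k d3 => [|k _]; first by rewrite !mul0r oppr0 mul0r scale0r scaler0.
rewrite /= -exprVn expr2 [y^-1 ^+ k.+2]exprS [y^-1 ^+ k.+1]exprS -[LHS]/(w * (k.+1%:R *
  y^-1 ^+ k * (- (y^-1 * y^-1) * x))).
by move: (k.+1%:R : R) (y^-1) (y^-1 ^+ k) => p q r; ring.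
Qed.

Lemma power_fun_rderive (a b w : R) k j z v : Omega z ->
  has_rderive (power_fun a b w k j) z v
    (power_fun (b * complex.Im (v 0 (rI j))) 0 (- (k%:R * w * complex.Im (v 0 (rI j))))
      k.+1 j z).
Proof.
move=> Oz; have d := is_derive_power_fun a b w k (complex.Im (v 0 (rI j))) (Oz j).
split; rewrite /along /power_fun /=; last exact: is_derive_cst.
rewrite mul0r addr0.
by under eq_fun do rewrite !mxE Im_add Im_realM.
Qed.

Lemma power_fun_continuous (a b w : R) k j z : Omega z ->
  {for z, continuous (power_fun a b w k j)}.
Proof.
move=> Oz; have c := @continuous_Im_coord z (rI j).
have yn : complex.Im (z 0 (rI j)) != 0 by rewrite gt_eqF.
have cp : {for z, continuous (fun x : V => (complex.Im (x 0 (rI j)))^-1 ^+ k)}.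
  rewrite /prop_for /continuous_at; elim: k => [|k IH].
    exact: (@cvg_cst R (1 : R) V (nbhs z) (nbhs_filter z)).
  have -> : (fun x : V => (complex.Im (x 0 (rI j)))^-1 ^+ k.+1) = fun x :
    V => (complex.Im (x 0 (rI j)))^-1 * (complex.Im (x 0 (rI j)))^-1 ^+ k.
    by apply/funext => x; rewrite exprS.
  by rewrite exprS; exact: (cvgM (cvgV yn c) IH).
have F := nbhs_filter z.
have cr := @cvgD _ _ _ _ F _ _ _ _ (@cvgD _ _ _ _ F _ _ _ _ (cvg_cst a) (@cvgM _ _ _ F _
  _ _ _ (cvg_cst b) c)) (@cvgM _ _ _ F _ _ _ _ (cvg_cst w) cp).
exact: (@continuous_to_Cx R V (power_fun a b w k j) z (cr F F F) (@cvg_cst R (0 :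
  R) V (nbhs z) F)).
Qed.

Lemma power_fun_smooth (a b w : R) k j : smooth_on Omega (power_fun a b w k j).
Proof.
move=> m; elim: m a b w k => [|m IH] a b w k.
  by split; last by []; move=> z Oz; exact: power_fun_continuous.
split; first by move=> z Oz; exact: power_fun_continuous.
move=> v; split.
  by move=> z Oz; have [] := has_rderivableE (power_fun_rderive a b w k j v Oz).
have := IH (b * complex.Im (v 0 (rI j))) 0 (- (k%:R * w * complex.Im (v 0 (rI j)))) k.+1.
apply: Ck_near; first exact: open_OT_domain.
by move=> z Oz; have [_ ->] := has_rderivableE (power_fun_rderive a b w k j v Oz).
Qed.

Lemma power_fun0 k j z : power_fun 0 0 0 k j z = 0.
Proof. by rewrite /power_fun !mul0r !addr0. Qed.

Lemma Im_real_dir q j : complex.Im ((real_dir R q : V) 0 (rI j)) = 0.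
Proof. by rewrite !mxE eqxx /=; case: eqP. Qed.

Lemma Im_imag_dir q j : complex.Im ((imag_dir R q : V) 0 (rI j)) = (rI j == q)%:R.
Proof. by rewrite !mxE eqxx -complexiE /=; case: eqP => _ /=;
  rewrite ?mulr0 ?mulr1 ?mul0r ?add0r ?addr0. Qed.

Lemma power_fun_real_dir (a b w : R) k j q z : Omega z ->
  rderive (real_dir R q) (power_fun a b w k j) z = 0.
Proof.
move=> Oz; have [_ ->] := has_rderivableE (power_fun_rderive a b w k j (real_dir R q) Oz).
by rewrite Im_real_dir !mulr0 oppr0 power_fun0.
Qed.

Lemma power_fun_imag_dir (a b w : R) k j q z : Omega z ->
  rderive (imag_dir R q) (power_fun a b w k j) z =
  power_fun (b * (rI j == q)%:R) 0 (- (k%:R * w * (rI j == q)%:R)) k.+1 j z.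
Proof.
move=> Oz; have [_ ->] := has_rderivableE (power_fun_rderive a b w k j (imag_dir R q) Oz).
by rewrite Im_imag_dir.
Qed.

(** A function of y_j alone has only its second derivative in y_j left, which requires p = q =
    [rI j]; [k%:R * w == 0] is the case of an affine function. *)
Lemma ddc_power_fun (a b w : R) k j p q z : Omega z ->
  (k%:R * w == 0) || (p != rI j) || (q != rI j) ->
  wdel p (wbar q (power_fun a b w k j)) z = 0.
Proof.
move=> Oz hz; set f1 := power_fun (b * (rI j == q)%:R) 0 (- (k%:R * w * (rI j == q)%:R))
  k.+1 j.
(* The dummy term with coefficient 0 gives the two-term shape expected by [wdel_lincomb]. *)
have E x : Omega x -> 'i / 2 * f1 x + 0 * f1 x = wbar q (power_fun a b w k j) x.
  by move=> Ox; rewrite /wbar power_fun_real_dir // power_fun_imag_dir // mulr0 add0r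
    mul0r addr0.
have sf : smooth_on Omega f1 by exact: power_fun_smooth.
rewrite (wdel_eq_on p (@open_OT_domain R s t) E _ Oz); last first.
  exact: (smooth_on_lincomb _ _ (@open_OT_domain R s t) sf sf).
rewrite (wdel_lincomb p _ _ sf sf Oz) mul0r addr0 /wdel {1 2}/f1 power_fun_real_dir //
  power_fun_imag_dir // mul0r mulr0 add0r.
suff -> : - (k.+1%:R * - (k%:R * w * (rI j == q)%:R) * (rI j == p)%:R) = 0 :> R
  by rewrite power_fun0 !mulr0.
case/orP: hz => [/orP[/eqP ->|pj]|qj].
- by rewrite mul0r oppr0 mulr0 mul0r oppr0.
- by rewrite [_ == p]eq_sym (negbTE pj) mulr0 oppr0.
- by rewrite [_ == q]eq_sym (negbTE qj) mulr0 oppr0 mulr0 mul0r oppr0.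
Qed.

Variable jj : 'I_t -> 'I_s.
Hypothesis jjP : forall (a : 'I_t) u, U u -> sre (jj a) u * cnorm2 a u = 1.

Definition std_entry (i : 'I_(s + t)) : V -> C :=
  match fintype.split i with inl j => power_fun 0 0 1 2 j | inr a => power_fun 0 1 0 0
    (jj a) end.

Definition std_metric z : 'M[C]_(s + t) := diag_mx (\row_i std_entry i z).

Lemma std_entry_gt0 i z : Omega z -> 0 < std_entry i z.
Proof.
rewrite /std_entry => Oz; case: (fintype.split i) => j; rewrite /power_fun ltcR.
  by rewrite mul0r !addr0 add0r mul1r exprn_gt0 // invr_gt0.
by rewrite mul0r add0r addr0 mul1r; exact: Oz.
Qed.

Lemma std_entry_smooth i k : smooth_on Omega (fun z => std_metric z i k).
Proof.
have -> : (fun z => std_metric z i k)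
  = if i == k then std_entry i else power_fun 0 0 0 0 (Ordinal hs).
  apply/funext => z; rewrite !mxE; case: eqP => _; first by rewrite mulr1n.
  by rewrite mulr0n power_fun0.
case: eqP => _; last exact: power_fun_smooth.
by rewrite /std_entry; case: (fintype.split i) => j; exact: power_fun_smooth.
Qed.

(** The matrix is diagonal, its complex entries are affine in y, and each real entry depends only on
    its own y_j. *)
Lemma std_ddc p q i l z : Omega z -> ~~ [&& p == q, q == i & i == l] ->
  wdel p (wbar q (fun x => std_metric x i l)) z = 0.
Proof.
move=> Oz hne.
have [il|il] := eqVneq i l; last first.
  have -> : (fun x => std_metric x i l) = power_fun 0 0 0 0 (Ordinal hs).
    by apply/funext => x; rewrite !mxE (negbTE il) mulr0n power_fun0.
  by apply: (ddc_power_fun _ _ Oz); rewrite mulr0 eqxx.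
have -> : (fun x => std_metric x i l) = std_entry i.
  by apply/funext => x; rewrite !mxE il eqxx mulr1n.
move: hne; rewrite il eqxx andbT /std_entry.
case: (split_ordP l) => [j lE|a _] hne; apply: (ddc_power_fun _ _ Oz);
  last by rewrite mulr0 eqxx.
by move: hne; rewrite lE; case: (eqVneq q (rI j)) => [->|_];
  rewrite ?orbT // andbT orbF => ->; rewrite orbT.
Qed.

Lemma std_equivariant g z i : U g.2 -> Omega z ->
  std_entry i z = sigma (lshift t i) g.2 * std_entry i (OT_act sigma g z) * (sigma
    (lshift t i) g.2)^*.
Proof.
move=> Ug Oz; rewrite mulrAC -normCK.
rewrite /std_entry; case: (split_ordP i) => [j ->|a ->].
  have y0 := Oz j; have r0 := sre_gt0 j Ug.
  rewrite -/(real_idx t j) sigma_real normCxE normc_real gtr0_norm // -rmorphXn -rmorphM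
    /power_fun act_Im.
  congr ((_)%:C)%C; rewrite !mul0r !addr0 !add0r !mul1r.
  by field; rewrite !gt_eqF.
rewrite -/(cplx_idx s a) cnorm2E -rmorphM /power_fun act_Im; congr ((_)%:C)%C.
rewrite !mul0r !addr0 !add0r !mul1r mulrA [cnorm2 _ _ * _]mulrC jjP //.
by rewrite mul1r.
Qed.

Lemma std_hermitian z : Omega z -> hermitian_posdef (std_metric z).
Proof.
move=> Oz; split.
  apply/matrixP => i l; rewrite !mxE eq_sym; case: eqP => [->|_];
    last by rewrite !mulr0n rmorph0.
  by rewrite !mulr1n; apply/esym/CrealP/gtr0_real/std_entry_gt0.
move=> v v0.
have -> : (v *m std_metric z *m conjtr v) 0 0 = \sum_i std_entry i z * `|v 0 i| ^+ 2.
  rewrite mxE; apply: eq_bigr => i _; rewrite mul_mx_diag !mxE normCK.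
  rewrite -mulrA mulrCA.
  by [].
have [i vi] : exists i, v 0 i != 0 by exact/rV0Pn.
rewrite (bigD1 i) //=; apply: ltr_pwDl.
  by rewrite mulr_gt0 ?std_entry_gt0 // exprn_gt0 // normr_gt0.
by apply: sumr_ge0 => l _; rewrite mulr_ge0 ?exprn_ge0 // ltW // std_entry_gt0.
Qed.

(** The element g is found at z alone; nearby, [g w] and [phi w] lie in the same orbit and in [c'],
    where the quotient map is injective. *)
Lemma transition_act c c' phi z : OT_manifold sigma U c -> OT_manifold sigma U c' ->
  is_transition c c' phi z -> exists2 g, OT_group U g & \forall w \near z,
    phi w = OT_act sigma g w.
Proof.
move=> Xc [e' oc' cO' inj'] [cz tr]; have e : c.2 = OT_orbit sigma U by case: Xc.
have [cz' ez'] := nbhs_singleton tr; rewrite e e' in ez'.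
have [g Gg gE] := orbit_eq (esym ez').
exists g => //.
have n1 : \forall w \near z, c'.1 (OT_act sigma g w).
  by apply: act_continuous; apply: open_nbhs_nbhs; split => //; rewrite -gE.
apply: filterS2 tr n1 => w [h1 h2] h3; apply: inj' => //.
by rewrite h2 e e' orbit_act.
Qed.

Lemma std_admits : admits_pluriclosed_metric (OT_manifold sigma U).
Proof.
exists (fun=> std_metric); split; first split.
- move=> c [_ _ cO _] i l m; apply: Ck_local => w cw; exists Omega; split; first exact: cO.
  exact: std_entry_smooth.
- by move=> c z [_ _ cO _] cz; apply/std_hermitian/cO.
- move=> c c' phi z Xc Xc' T; have [g Gg hphi] := transition_act Xc Xc' T.
  have Oz : Omega z by case: Xc T => _ _ cO _ [/cO].
  rewrite (jacobian_near_act hphi) (nbhs_singleton hphi).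
  apply/matrixP => i l; rewrite /conjtr [in RHS]/std_metric mul_diag_mx.
  have -> : map_mx Num.conj (diag_mx (\row_i sigma (lshift t i) g.2))^T
    = diag_mx (\row_i (sigma (lshift t i) g.2)^*).
    apply/matrixP => p q; rewrite !mxE eq_sym; case: eqP => [->|_];
      rewrite ?mulr1n ?mulr0n ?rmorph0 //.
  rewrite mul_mx_diag !mxE; case: eqP => [->|_]; last by rewrite !mulr0n mulr0 mul0r.
  by rewrite !mulr1n; apply: std_equivariant => //; case: Gg.
move=> c [_ _ cO _] J L z /cO Oz.
have Z := std_ddc Oz.
rewrite (ddc_expand J L (@open_OT_domain R s t) std_entry_smooth Oz) /=.
have F (i a b c1 d : C) : a = b -> c1 = d -> i * ((a - b) - (c1 - d)) = 0.
  by move=> -> ->; rewrite !subrr mulr0.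
have F0 (i a b c1 d : C) : a = 0 -> b = 0 -> c1 = 0 -> d = 0 ->
  i * ((a - b) - (c1 - d)) = 0.
  by move=> -> -> -> ->; rewrite !subrr mulr0.
(* Equal antiholomorphic indices cancel by antisymmetry; if they differ, no term has its four
   indices equal. *)
have [|hne] := eqVneq (L ord0) (L ord_max).
  by move: (L ord0) (L ord_max) => x y ->; apply: F; reflexivity.
have ne1 p q : ~~ [&& p == L ord0, L ord0 == q & q == L ord_max].
  by apply: contra hne => /and3P[_ /eqP -> /eqP ->].
have ne2 p q : ~~ [&& p == L ord_max, L ord_max == q & q == L ord0].
  by apply: contra hne => /and3P[_ /eqP -> /eqP ->].
exact: F0 (Z _ _ _ _ (ne1 _ _)) (Z _ _ _ _ (ne2 _ _)) (Z _ _ _ _ (ne1 _ _)) (Z _ _ _ _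
  (ne2 _ _)).
Qed.

(** * Lift of a given metric to H^s x C^t *)

Variable h : parametrization R (s + t) (set V) -> V -> 'M[C]_(s + t).
Local Notation X := (OT_manifold sigma U).
Hypothesis h_metric : hermitian_metric X h.
Hypothesis h_pc : pluriclosed X h.

Lemma metric_act c c' g z : X c -> X c' -> OT_group U g -> c.1 z ->
  c'.1 (OT_act sigma g z) ->
  forall j k, h c z j k = sigma (lshift t j) g.2 * h c' (OT_act sigma g z) j k * (sigma
    (lshift t k) g.2)^*.
Proof.
move=> Xc Xc' Gg cz cgz j k; have [_ _ tr] := h_metric.
have T : is_transition c c' (OT_act sigma g) z.
  split => //; have [oc' oc''] : open c'.1 /\ c'.2 = OT_orbit sigma U by case: Xc'.
  have e2 : c.2 = OT_orbit sigma U by case: Xc.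
  have n1 : \forall w \near z, c'.1 (OT_act sigma g w).
    exact: (act_continuous (open_nbhs_nbhs (conj oc' cgz))).
  by apply: filterS n1 => w cw; split => //; rewrite oc'' e2 orbit_act.
rewrite (tr c c' _ z Xc Xc' T) (@jacobian_near_act g z); last by apply: filterE.
rewrite /conjtr mul_diag_mx.
have -> : map_mx Num.conj (diag_mx (\row_i sigma (lshift t i) g.2))^T
  = diag_mx (\row_i (sigma (lshift t i) g.2)^*).
  apply/matrixP => p q; rewrite !mxE eq_sym; case: eqP => [->|_];
    rewrite ?mulr1n ?mulr0n ?rmorph0 //.
by rewrite mul_mx_diag !mxE.
Qed.

Definition chart_set z : set V :=
  if pselect (Omega z) is left Oz then sval (cid (chart_exists Oz)) else set0.

Definition chart_at z : parametrization R (s + t) (set V) := (chart_set z,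
  OT_orbit sigma U).

Lemma chart_atP z : Omega z -> X (chart_at z) /\ (chart_at z).1 z.
Proof.
move=> Oz; rewrite /chart_at /chart_set; case: pselect => // Oz'.
by case: (cid _) => W /= [Wz oW WO inj].
Qed.

Definition metric_at z : 'M[C]_(s + t) := h (chart_at z) z.

(** The pull-back is independent of the chosen charts: two charts around z are related by the
    identity element, whose Jacobian is trivial. *)
Lemma metric_at_chart c z : X c -> c.1 z -> metric_at z = h c z.
Proof.
move=> Xc cz; have Oz : Omega z by case: Xc => _ _ /(_ z cz).
have [Xz zz] := chart_atP Oz; apply/matrixP => j k.
have := @metric_act (chart_at z) c (0, 1) z Xz Xc group1 zz; rewrite act1 => /(_ cz j k) ->.
by rewrite /= !rmorph1 mul1r mulr1.
Qed.

Lemma metric_at_act g z : OT_group U g -> Omega z -> forall j k,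
  metric_at z j k = sigma (lshift t j) g.2 * metric_at (OT_act sigma g z) j k * (sigma
    (lshift t k) g.2)^*.
Proof.
move=> Gg Oz j k; have [Xz zz] := chart_atP Oz.
have Ogz : Omega (OT_act sigma g z) by apply: act_domain => //; case: Gg.
by have [Xg gg] := chart_atP Ogz; exact: metric_act.
Qed.

Lemma metric_at_posdef z : Omega z -> hermitian_posdef (metric_at z).
Proof. by move=> /chart_atP[Xz zz]; have [_ + _] := h_metric; exact. Qed.

Lemma metric_at_diag_gt0 z j : Omega z -> 0 < metric_at z j j.
Proof.
move=> /metric_at_posdef[_ /(_ (delta_mx 0 j))]; have d0 : delta_mx 0 j != 0 :> V.
  by apply/eqP => /rowP/(_ j)/eqP; rewrite !mxE !eqxx oner_eq0.
move=> /(_ d0); rewrite -rowE /conjtr mxE (bigD1 j) //= big1 ?addr0.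
  by rewrite !mxE !eqxx /= rmorph1 mulr1.
by move=> i ij; rewrite !mxE (negbTE ij) andbF rmorph0 mulr0.
Qed.

Lemma metric_at_smooth j k : smooth_on Omega (fun z => metric_at z j k).
Proof.
move=> m; apply: Ck_local => z Oz; have [Xz zz] := chart_atP Oz.
exists (chart_at z).1; split => //; have [sm _ _] := h_metric.
apply: Ck_near (sm _ Xz j k m); first by case: Xz.
by move=> w cw; rewrite (metric_at_chart Xz cw).
Qed.

Lemma ddc_eq_on (W : set V) (H H' : V -> 'M[C]_(s + t)) J L z : open W ->
  (forall w, W w -> H w = H' w) -> (forall j k, smooth_on W (fun z => H z j k)) -> W z ->
  del (delbar (fundamental_form H)) J L z = del (delbar (fundamental_form H')) J L z.
Proof.
move=> oW HH sH Wz.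
have sH' j k : smooth_on W (fun z => H' z j k).
  by apply: smooth_on_ext (sH j k) => // w Ww; rewrite HH.
have E p q r l : wdel p (wbar q (fun z => H z r l)) z
  = wdel p (wbar q (fun z => H' z r l)) z.
  apply/esym; apply: (wdel_eq_on p oW) (smooth_on_wbar q oW (sH r l)) Wz => w Ww.
  rewrite /wbar; congr (_ * _ + _ * _); symmetry.
    apply: (rderive_eq_on oW) => // [v Wv|]; first by rewrite HH.
    exact: smooth_on_rderivable (sH r l) Ww.
  apply: (rderive_eq_on oW) => // [v Wv|]; first by rewrite HH.
  exact: smooth_on_rderivable (sH r l) Ww.
rewrite (ddc_expand J L oW sH Wz) (ddc_expand J L oW sH' Wz) /=.
have F (i a b c d a' b' c' d' : C) : a = a' -> b = b' -> c = c' -> d = d' ->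
    i * ((a - b) - (c - d)) = i * ((a' - b') - (c' - d')) by move=> -> -> -> ->.
exact: F (E _ _ _ _) (E _ _ _ _) (E _ _ _ _) (E _ _ _ _).
Qed.

Lemma metric_at_pluriclosed J L z : Omega z ->
  del (delbar (fundamental_form metric_at)) J L z = 0.
Proof.
move=> Oz; have [Xz zz] := chart_atP Oz; have [_ oW WO _] := Xz.
rewrite (@ddc_eq_on (chart_at z).1 metric_at (h (chart_at z)) J L z oW) //.
- exact: h_pc.
- by move=> w Ww; exact: metric_at_chart.
- move=> j k m; apply: Ck_local => w Ww; exists Omega; split;
  [exact: WO|exact: metric_at_smooth].
Qed.

Definition OK_periodic (f : V -> C) := forall a z, ring_of_integers a -> Omega z ->
  f (OT_act sigma (a, 1) z) = f z.

Definition OK_nice (f : V -> C) := smooth_on Omega f /\ OK_periodic f.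

Lemma act_translation a z : OT_act sigma (a, 1) z = z + \row_i sigma (lshift t i) a.
Proof. by apply/rowP => i; rewrite !mxE /= rmorph1 mul1r. Qed.

Lemma OK_nice_smooth f : OK_nice f -> smooth_on Omega f. Proof. by case. Qed.

Lemma continuous_normc_bounded (B : set V) (f : V -> C) : compact B ->
  (forall z, B z -> {for z, continuous f}) -> exists M, forall z, B z -> normc (f z) <= M.
Proof.
move=> cB cf.
have [M1 h1] := @compact_bounded _ _ B (fun z => complex.Re (f z) : R) cB
  (fun z Bz => @continuous_comp _ _ _ f (fun x : C => complex.Re x :
    R) z (cf z Bz) (@continuous_Re R (f z))).
have [M2 h2] := @compact_bounded _ _ B (fun z => complex.Im (f z) : R) cB
  (fun z Bz => @continuous_comp _ _ _ f (fun x : C => complex.Im x :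
    R) z (cf z Bz) (@continuous_Im R (f z))).
by exists (M1 + M2) => z Bz; apply: le_trans (normc_le _) (lerD (h1 z Bz) (h2 z Bz)).
Qed.

(** Translations by O_K bring every point of the box into one compact set, where continuity gives a
    bound. *)
Lemma OK_nice_bounded f (al be : R) : OK_nice f -> 0 < al ->
  exists B, bounded_on (imbox al be) f B.
Proof.
move=> [sf pf] al0; have [B [cB BO cov]] := OK_cocompact be al0.
have [M hM] := continuous_normc_bounded cB (fun z Bz => smooth_on_continuous sf (BO z Bz)).
exists M => z zS; have [a ia Bz] := cov z zS.
by rewrite -(pf a z ia (imbox_sub al0 zS)) hM.
Qed.

Lemma OK_nice_rderive f v : OK_nice f -> OK_nice (rderive v f).
Proof.
move=> [sf pf]; split; first exact: smooth_on_rderive.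
move=> a z ia Oz.
have Oaz : Omega (OT_act sigma (a, 1) z) by apply: act_domain => //; exact: U1.
have rd := smooth_on_rderivable v sf Oaz.
rewrite act_translation in Oaz rd *.
have [rd' <-] := rderive_shift rd.
apply/esym/(rderive_eq_on (@open_OT_domain R s t) _ Oz rd') => w Ow.
by rewrite -act_translation pf.
Qed.

Lemma OK_nice_lincomb f f2 (a b : C) : OK_nice f -> OK_nice f2 ->
  OK_nice (fun z => a * f z + b * f2 z).
Proof.
move=> [sf pf] [sg pg]; split; first exact: (smooth_on_lincomb a b (@open_OT_domain R s
  t) sf sg).
by move=> c z ic Oz; rewrite pf // pg.
Qed.

Lemma OK_nice_metric_at j k : OK_nice (fun z => metric_at z j k).
Proof.
split; first exact: metric_at_smooth.
move=> a z ia Oz; rewrite [RHS](@metric_at_act (a, 1)) //;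
  first by rewrite /= !rmorph1 mul1r mulr1.
by split => //; exact: U1.
Qed.

(** * Multiplicative relations on U and the relabelling *)

Lemma power_bounded_le1 (q c M : R) : 0 < c -> (forall n, c * q ^+ n <= M) -> q <= 1.
Proof.
move=> c0 hb; rewrite leNgt; apply/negP => q1.
have bern n : 1 + n%:R * (q - 1) <= q ^+ n.
  elim: n => [|n IH]; first by rewrite mul0r addr0 expr0.
  rewrite exprS; apply: le_trans (ler_wpM2l (ltW (lt_trans ltr01 q1)) IH).
  rewrite -natr1; have : 0 <= n%:R * (q - 1) * (q - 1) :> R.
    by rewrite !mulr_ge0 // ?ler0n // subr_ge0 ltW.
  lra.
have q0 : 0 < q - 1 by rewrite subr_gt0.
have M0 : 0 <= M by apply: le_trans (hb 0%N); rewrite expr0 mulr1 ltW.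
have := archi_boundP (divr_ge0 (divr_ge0 M0 (ltW c0)) (ltW q0)).
set n := Num.bound _; rewrite ltr_pdivrMr // ltr_pdivrMr // => hn.
have := le_trans (ler_wpM2l (ltW c0) (bern n)) (hb n).
rewrite mulrDr mulr1 => h2.
have : c + c * (n%:R * (q - 1)) < c * (n%:R * (q - 1)).
  by apply: le_lt_trans h2 _; rewrite [ltRHS]mulrC.
by rewrite gtrDr => /(lt_trans c0); rewrite ltxx.
Qed.

(* The average over the torus of the coefficient of dw_a dwbar_a is
   e0 + sum_j c_j y_j, and at y = (sigma_j(u))_j it is O(|sigma_a(u)|^-2).  Hence, when
   c_j > 0, the powers of sigma_j(u) |sigma_a(u)|^2 are bounded, and likewise for e0. *)
Lemma weight_dichotomy (a : 'I_t) :
  (forall u, U u -> cnorm2 a u = 1) \/ exists j, forall u, U u -> sre j u * cnorm2 a u = 1.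
Proof.
have [c0 [c hL]] := affine_limit OK_nice_smooth OK_nice_bounded OK_nice_rderive
  OK_nice_lincomb
  OK_nice_metric_at metric_at_pluriclosed a.
pose A := cI a; pose f z := complex.Re (metric_at z A A).
pose L y := c0 + \sum_j (y j - 1) * c j.
have f0 z : Omega z -> 0 < f z.
  by move=> /(metric_at_diag_gt0 A); rewrite ltcE => /andP[].
have slice_Omega y z : (forall j, 0 < y j) ->
  (forall j : 'I_s, complex.Im (z 0 (rI j)) = y j) -> Omega z.
  by move=> y0 zy j; rewrite zy.
(* [affine_limit] takes both bounds at once; the upper one is supplied by boundedness of the
   periodic coefficient. *)
have low y lo : (forall j, 0 < y j) ->
  (forall z, (forall j : 'I_s, complex.Im (z 0 (rI j)) = y j) -> lo <= f z) -> lo <= L y.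
  move=> y0 hlo.
  have m0 : 0 < \big[Num.min/1]_j y j by apply/lt_bigmin.
  have [B hB] := OK_nice_bounded (\big[Num.max/1]_j y j) (OK_nice_metric_at A A) m0.
  suff hb z : (forall j : 'I_s, complex.Im (z 0 (rI j)) = y j) ->
    lo <= complex.Re (metric_at z A A) <= B.
    by have /andP[] := hL y y0 lo B hb.
  move=> zy; rewrite [_ <= _](hlo z zy) /=.
  apply: le_trans (ler_norm _) _; apply: le_trans (Re_le_normc _) _; apply: hB => j.
  by rewrite zy bigmin_le_cond // le_bigmax_cond.
have Lge0 y : (forall j, 0 < y j) -> 0 <= L y.
  by move=> y0; apply: low => // z zy; apply/ltW/f0/(slice_Omega y).
have up y hi : (forall j, 0 < y j) ->
  (forall z, (forall j : 'I_s, complex.Im (z 0 (rI j)) = y j) -> f z <= hi) -> L y <= hi.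
  move=> y0 hhi.
  suff hb z : (forall j : 'I_s, complex.Im (z 0 (rI j)) = y j) ->
    0 <= complex.Re (metric_at z A A) <= hi.
    by have /andP[] := hL y y0 0 hi hb.
  by move=> zy; rewrite [_ <= hi](hhi z zy) andbT; apply/ltW/f0/(slice_Omega y).
have L1 : L (fun=> 1) = c0 by rewrite /L big1 ?addr0 // => j _; rewrite subrr mul0r.
(* On the slice y = 1 the coefficient takes all its values on a compact set, hence has a positive
   minimum. *)
have c00 : 0 < c0.
  have [B [cB BO cov]] := OK_cocompact 1 (ltr01 : 0 < 1 :> R).
  have [d d0 hd] := @compact_lower _ _ B f cB
    (fun z Bz => @continuous_comp _ _ _ (fun z => metric_at z A A) (fun x :
      C => complex.Re x : R) z
       (smooth_on_continuous (metric_at_smooth A A) (BO z Bz)) (@continuous_Re R _)) (fun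
         z Bz => f0 z (BO z Bz)).
  rewrite -L1; apply: lt_le_trans d0 _; apply: low => // z zy.
  have Oz : Omega z by apply: (slice_Omega (fun=> 1)).
  have [j|b imag_dir Bz] := cov z; first by rewrite zy lexx.
  by have [_ pf] := OK_nice_metric_at A A; rewrite /f -(pf b z imag_dir Oz); exact: hd.
have cge0 j : 0 <= c j.
  rewrite leNgt; apply/negP => cj.
  (* Moving y_j this far from 1 would give L the value -1. *)
  have e0 : 0 < (c0 + 1) / (- c j) by rewrite divr_gt0 ?oppr_gt0 ?addr_gt0.
  have := Lge0 (fun i => if i == j then 1 + (c0 + 1) / (- c j) else 1).
  rewrite /L (bigD1 j) //= eqxx big1 ?addr0; last by move=> i /negbTE ->;
    rewrite subrr mul0r.
  have -> : (1 + (c0 + 1) / - c j - 1) * c j = - (c0 + 1).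
    by field; rewrite lt_eqF.
  move=> h1; have : 0 <= c0 - (c0 + 1).
    by apply: h1 => i; case: ifP => // _; rewrite addr_gt0.
  lra.
pose e0 := c0 - \sum_j c j.
have LE y : L y = e0 + \sum_j y j * c j.
  rewrite /L /e0 -addrA; congr (_ + _); rewrite addrC -sumrB; apply: eq_bigr => j _; ring.
have e00 : 0 <= e0.
  have S0 : 0 <= \sum_j c j by apply: sumr_ge0.
  rewrite leNgt; apply/negP => en.
  (* Near y = 0 the constant term dominates: at y = (ep, .., ep) a negative [e0] would give L <= e0
     / 2. *)
  pose ep := (- e0) / (\sum_j c j + 1) / 2.
  have ep0 : 0 < ep by rewrite /ep !divr_gt0 ?oppr_gt0 // ltr_wpDl.
  have := Lge0 (fun=> ep) (fun _ => ep0); rewrite LE -mulr_sumr => h1.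
  have h2 : ep * (\sum_j c j + 1) = - e0 / 2
    by rewrite /ep mulrAC divfK // gt_eqF // ltr_wpDl.
  by nra.
(* D bounds the coefficient on the slice y = 1, and equivariance transports this bound by u. *)
have [D hD] : exists D, forall u, U u -> L (fun j => sre j u) * cnorm2 a u <= D.
  have [D hD] := OK_nice_bounded 1 (OK_nice_metric_at A A) (ltr01 : 0 < 1 :> R).
  exists D => u Uu; have n0 := cnorm2_gt0 a (U_neq0 Uu).
  rewrite -ler_pdivlMr //; apply: up => [j|z zy]; first exact: sre_gt0.
  have Oz : Omega z by apply: (slice_Omega (fun j => sre j u)) => // j; exact: sre_gt0.
  pose z' := OT_act sigma (0, u^-1) z.
  have Gu : OT_group U (0, u) by split => //; exact: int_0.
  have zE : OT_act sigma (0, u) z' = z.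
    by rewrite /z' act_comp /= mulr0 addr0 mulfV ?U_neq0 // act1.
  have Oz' : Omega z' by apply: act_domain => //; exact: UV.
  have := metric_at_act Gu Oz' A A; rewrite zE /= mulrAC -/(cplx_idx s a) -normCK => e.
  have e' : complex.Re (metric_at z' A A) = cnorm2 a u * f z.
    by rewrite e normCxE -rmorphXn Re_realM.
  rewrite ler_pdivlMr // mulrC -e'.
  apply: le_trans (ler_norm _) _; apply: le_trans (Re_le_normc _) _; apply: hD => j.
  have := act_Im (0, u) z' j; rewrite zE zy /= -[X in X
    = _]mulr1 => /(mulfI (lt0r_neq0 (sre_gt0 j Uu))) <-.
  by rewrite lexx.
(* A bounded multiplicative q is at most 1 on U; applied to u and u^-1, this gives 1. *)
have bounded (w : R) (q : K -> R) : 0 < w -> (forall u v : K, q (u * v) = q u * q v) ->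
  (forall u, U u -> 0 < q u) ->
    (forall u, U u -> w * q u <= D) -> forall u, U u -> q u = 1.
  move=> w0 qM q0 qD.
  have q1 : q 1 = 1.
    by have := qM 1 1; rewrite mulr1 => e; apply: (mulfI (lt0r_neq0 (q0 1 U1)));
      rewrite -e mulr1.
  have pw u n : U u -> U (u ^+ n) /\ q (u ^+ n) = q u ^+ n.
    move=> Uu; elim: n => [|n [IH1 IH2]]; first by rewrite !expr0 q1; split => //;
      exact: U1.
    by rewrite !exprS qM IH2; split => //; exact: UM.
  have le1 u : U u -> q u <= 1.
    move=> Uu; apply: (power_bounded_le1 w0) => n.
    by have [Un <-] := pw u n Uu; exact: qD.
  move=> u Uu; apply/eqP; rewrite eq_le le1 //=.
  have := le1 _ (UV Uu); have : q u * q u^-1 = 1 by rewrite -qM mulfV ?U_neq0.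
  move=> e h1; rewrite -e -[leRHS]mulr1 ler_pM2l //; exact: q0.
have hsum u j : U u -> 0 <= sre j u * c j.
  by move=> Uu; rewrite mulr_ge0 // ltW // sre_gt0.
have [e0z|e0n] := eqVneq e0 0; last first.
  left; apply: (@bounded e0); rewrite ?lt0r ?e0n //; first exact: cnorm2M.
    by move=> u /U_neq0; exact: cnorm2_gt0.
  move=> u Uu; apply: le_trans (hD u Uu); rewrite LE ler_pM2r ?cnorm2_gt0 ?U_neq0 //.
  by rewrite lerDl sumr_ge0 // => j _; exact: hsum.
(* With zero constant term, L(1) = c0 > 0 must come from some [c j]. *)
right; have [j cj] : exists j, 0 < c j.
  apply: contrapT => hn; have cz j : c j = 0.
    by apply/eqP; rewrite eq_le cge0 andbT leNgt; apply/negP => ?; apply: hn; exists j.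
  by move: c00; rewrite -L1 LE e0z add0r big1 ?ltxx // => j _; rewrite cz mulr0.
exists j; apply: (@bounded (c j)) => //.
- by move=> u v; rewrite cnorm2M /sre rmorphM !sigma_real -rmorphM /=; ring.
- by move=> u Uu; rewrite mulr_gt0 ?sre_gt0 ?cnorm2_gt0 ?U_neq0.
move=> u Uu; apply: le_trans (hD u Uu); rewrite mulrA ler_pM2r ?cnorm2_gt0 ?U_neq0 //.
rewrite LE e0z add0r (bigD1 j) //= [c j * _]mulrC lerDl sumr_ge0 // => i _; exact: hsum.
Qed.

Lemma real_norm_unit u : U u -> (\prod_j sre j u) * (\prod_a cnorm2 a u) = 1.
Proof.
move=> Uu; have := norm_unit hsigma (U_pos Uu).
under eq_bigr do rewrite sigma_real; under [X in _ * X]eq_bigr do rewrite cnorm2E.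
by rewrite -!rmorph_prod -rmorphM /= => -[].
Qed.

Lemma normc_embedding k u : (exists j,
  normc (sigma k u) = `|sre j u|) \/ exists a : 'I_t, normc (sigma k u) ^+ 2 = cnorm2 a u.
Proof.
case: (split_ordP k) => [i ->|a ->].
  case: (split_ordP i) => [j ->|a ->]; [left; exists j|right; exists a] => //.
  by rewrite -/(real_idx t j) sigma_real normc_real.
right; exists a; case: hsigma => _ _ _ _ /(_ a u) e.
rewrite -/(conj_idx s a) e /cnorm2; congr (_ ^+ 2).
by case: (sigma (cplx_idx s a) u) => x y /=; rewrite sqrrN.
Qed.

(* Take u with all sigma_j(u) > 1.  The inverse of the largest one, x, would be a
   conjugate of u, but all the conjugates of u have modulus at least x^(-1/2). *)
Lemma not_all_unit_modulus (a : 'I_t) : ~ (forall u, U u -> cnorm2 a u = 1).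
Proof.
move=> n1; have [u Uu hu] := sign_pattern xpredT.
have u0 := U_neq0 Uu.
have na : `|sigma (cplx_idx s a) u| = 1.
  have : `|sigma (cplx_idx s a) u| ^+ 2 = 1 by rewrite cnorm2E n1.
  by move=> /eqP; rewrite sqrp_eq1 // => /eqP.
pose j0 := [arg max_(j > Ordinal hs) sre j u]%O.
have jmax j : sre j u <= sre j0 u.
  by rewrite /j0; case: arg_maxP => //= i _ hi; exact: hi.
have x1 : 1 < sre j0 u := hu j0.
have x0 : 0 < sre j0 u := lt_trans ltr01 x1.
have [k kE] := conjugate_inverse hsigma u0 na (real_idx t j0).
have nk : normc (sigma k u) = (sre j0 u)^-1.
  by rewrite kE normcV sigma_real normc_real gtr0_norm.
have [[j]|[b]] := normc_embedding k u; rewrite nk.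
  move=> e; have := hu j; rewrite -(gtr0_norm (sre_gt0 j Uu)) -e => /lt_trans h1.
  by have := h1 1; rewrite invf_lt1 // => /(_ x1); rewrite ltxx.
(* With x the largest sigma_j(u), |sigma_b(u)|^2 = x^-2. It would be either 1, against x > 1, or the
   inverse of some sigma_j(u), which would then be x^2 > x. *)
rewrite exprVn => e; have [/(_ u Uu)|[j /(_ u Uu)]] := weight_dichotomy b; rewrite -e.
  move=> /eqP; rewrite invr_eq1 sqrf_eq1 => /orP[] /eqP e1.
    by move: x1; rewrite e1 ltxx.
  by move: x0; rewrite e1 ltr0N1.
move=> e2; have := jmax j; have x20 : sre j0 u ^+ 2 != 0 by rewrite expf_neq0 // gt_eqF.
have -> : sre j u = sre j0 u ^+ 2 by rewrite -[LHS]mulr1 -(mulVf x20) mulrA e2 mul1r.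
by rewrite expr2 ger_pMr // leNgt x1.
Qed.

(** The fibre sizes [m j] of [ja] are the exponents in an identity prod sigma_j(u) = prod
    sigma_j(u)^(m j); testing it on a unit adapted to [m] forces them all to be 1. *)
Lemma forward_condition : s = t /\
  exists sigma' : 'I_(s + t + t) -> {rmorphism K -> C},
    embedding_labelling sigma' /\
    forall u, U u -> forall (j : 'I_s) (k : 'I_t), j = k :> nat ->
      sigma' (real_idx t j) u * `|sigma' (cplx_idx s k) u| ^+ 2 = 1.
Proof.
have /choice[ja hja] (a : 'I_t) : exists j, forall u, U u -> sre j u * cnorm2 a u = 1.
  by have [/not_all_unit_modulus|] := weight_dichotomy a.
pose m j := #|[pred a : 'I_t | ja a == j]|.
(* Multiplied by the product of all [cnorm2 a u], both sides are 1: the left by the norm, the right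
   by the choice of [ja]. *)
have prodE u : U u -> \prod_j sre j u = \prod_j sre j u ^+ m j.
  move=> Uu; have := real_norm_unit Uu => e.
  have -> : \prod_j sre j u ^+ m j = \prod_a sre (ja a) u.
    rewrite (partition_big ja xpredT) //=; apply: eq_bigr => j _.
    rewrite (eq_bigr (fun=> sre j u)); last by move=> a /eqP ->.
    by rewrite -prodr_const; apply: eq_bigl => a; rewrite inE.
  have e2 : (\prod_a sre (ja a) u) * (\prod_a cnorm2 a u) = 1.
    by rewrite -big_split big1 //= => a _; exact: hja.
  have n0 : \prod_a cnorm2 a u != 0.
    by rewrite gt_eqF //; apply: prodr_gt0 => a _; exact/cnorm2_gt0/U_neq0.
  by apply: (mulIf n0); rewrite e e2.
have m1 j : m j = 1%N.
  (* With sigma_i(u) > 1 where m i = 0 and < 1 elsewhere, each sigma_i(u)^(m i) <= sigma_i(u), with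
     equality only for m i = 1. *)
  have [u Uu hu] := sign_pattern (fun j => m j == 0%N).
  have le i : sre i u ^+ m i <= sre i u ?= iff (m i == 1%N).
    have := hu i; have r0 := sre_gt0 i Uu; case: (m i) => [|[|n]] /= r1.
    - by rewrite expr0; split; [exact: ltW|rewrite lt_eqF].
    - by rewrite expr1; split; rewrite ?lexx ?eqxx.
    - have h1 : sre i u ^+ n.+2 < sre i u.
        by rewrite exprS gtr_pMr // exprn_ilt1 // ltW.
      by split; [exact: ltW|rewrite lt_eqF].
  apply/eqP; apply: contraT => mj; have := prodE u Uu;
    rewrite (bigD1 j) //= [RHS](bigD1 j) //=.
  move=> e; have : sre j u ^+ m j * \prod_(i < s | i != j) sre i u ^+ m i < sre j u *
    \prod_(i < s | i != j) sre i u.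
    have p0 : 0 < \prod_(i < s | i != j) sre i u by apply: prodr_gt0 => i _; exact: sre_gt0.
    apply: (@le_lt_trans _ _ (sre j u ^+ m j * \prod_(i < s | i != j) sre i u)).
      rewrite ler_wpM2l ?exprn_ge0 ?(ltW (sre_gt0 j Uu)) //.
      apply: ler_prod => i _; rewrite exprn_ge0 ?(ltW (sre_gt0 i Uu)) //=; by case: (le i).
    by rewrite ltr_pM2r // lt_neqAle (le j) (negbTE mj) /=; case: (le j).
  by rewrite e ltxx.
have st : s = t.
  have : (\sum_(a < t) 1 = \sum_(j < s) m j)%N.
    rewrite (partition_big ja xpredT) //=; apply: eq_bigr => j _.
    by rewrite /m -sum1_card; apply: eq_bigl => a; rewrite inE.
  under [in RHS]eq_bigr do rewrite m1.
  by rewrite !sum1_card !card_ord.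
split=> //.
have ja_inj : injective ja.
  move=> a b e; have [c cE] := mem_card1 (m1 (ja b)).
  have := cE a; have := cE b; rewrite !inE e eqxx => /esym/eqP -> /esym/eqP ->.
  by [].
have /choice[tau htau] (k : 'I_t) : exists a : 'I_t, ja a = cast_ord (esym st) k.
  have [c cE] := mem_card1 (m1 (cast_ord (esym st) k)); exists c.
  by have := cE c; rewrite !inE eqxx => /eqP.
(* Only the non-real embeddings move: [tau] inverts [ja] up to s = t, and the conjugates follow
   it. *)
pose rho (i : 'I_(s + t + t)) : 'I_(s + t + t) :=
  match fintype.split i with
  | inl i1 => match fintype.split i1 with inl j => real_idx t j | inr k => cplx_idx s
    (tau k) end
  | inr k => conj_idx s (tau k)
  end.
have rhoR j : rho (real_idx t j) = real_idx t j.
  by rewrite /rho /real_idx (@unsplitK (s + t) t (inl _ _)) (@unsplitK s t (inl _ _)).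
have rhoC k : rho (cplx_idx s k) = cplx_idx s (tau k).
  by rewrite /rho /cplx_idx (@unsplitK (s + t) t (inl _ _)) (@unsplitK s t (inr _ _)).
have rhoJ k : rho (conj_idx s k) = conj_idx s (tau k).
  by rewrite /rho /conj_idx (@unsplitK (s + t) t (inr _ _)).
have tau_inj : injective tau.
  by move=> k k' e; apply: (@cast_ord_inj _ _ (esym st)); rewrite -!htau e.
have rho_inj : injective rho.
  move=> i i'.
  case: (split_ordP i) => [i1 ->|k ->]; case: (split_ordP i') => [i1' ->|k' ->].
  - case: (split_ordP i1) => [j ->|k ->]; case: (split_ordP i1') => [j' ->|k' ->].
    + by rewrite !rhoR.
    + by rewrite rhoR rhoC => /lshift_inj/eqP; rewrite eq_lrshift.
    + by rewrite rhoR rhoC => /lshift_inj/eqP; rewrite eq_rlshift.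
    + by rewrite !rhoC => /lshift_inj/rshift_inj/tau_inj ->.
  - rewrite rhoJ; case: (split_ordP i1) => [j ->|k ->].
      by rewrite rhoR => /eqP; rewrite eq_lrshift.
    by rewrite rhoC => /eqP; rewrite eq_lrshift.
  - rewrite rhoJ; case: (split_ordP i1') => [j ->|k' ->].
      by rewrite rhoR => /eqP; rewrite eq_rlshift.
    by rewrite rhoC => /eqP; rewrite eq_rlshift.
  - by rewrite !rhoJ => /rshift_inj/tau_inj ->.
have [l1 l2 l3 l4 l5] := hsigma.
exists (sigma \o rho); split.
  split=> /=.
  - by move=> i j /l1 /rho_inj.
  - move=> f; have [i fi] := l2 f; have [rho' _ rhoK] := injF_bij rho_inj.
    by exists (rho' i); rewrite rhoK.
  - by move=> j x; rewrite rhoR.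
  - by move=> j; rewrite rhoC.
  - by move=> j x; rewrite rhoJ rhoC.
move=> u Uu j k jk; rewrite /= rhoR rhoC cnorm2E sigma_real -rmorphM /=.
have -> : j = ja (tau k) by rewrite htau; apply/val_inj.
by rewrite hja.
Qed.

End Action.

(** * Comparison of two labellings *)

Lemma labelling_realP (R : realType) (s t : nat) (K : fieldExtType rat)
    (sigma : 'I_(s + t + t) -> {rmorphism K -> Cx R}) i :
  embedding_labelling sigma ->
  (exists j, i = real_idx t j) \/
  (exists2 k, i = cplx_idx s k \/ i = conj_idx s k & ~ (forall x, sigma i x \is Num.real)).
Proof.
move=> [_ _ _ nr cj]; case: (split_ordP i) => [i1 ->|k ->].
  case: (split_ordP i1) => [j ->|k ->]; first by left; exists j.
  by right; exists k; [left|exact: nr].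
right; exists k; first by right.
move=> h; apply: (nr k) => x; rewrite -CrealJ -cj; exact: h.
Qed.

(** The condition is given for [sigma'] while the atlas uses [sigma]. A relabelling may exchange an
    embedding with its conjugate, so only moduli are compared at the complex indices. *)
Lemma relabelling_index (R : realType) (s t : nat) (K : fieldExtType rat)
    (sigma sigma' : 'I_(s + t + t) -> {rmorphism K -> Cx R}) (a : 'I_t) : s = t ->
  embedding_labelling sigma -> embedding_labelling sigma' ->
  exists j (j' : 'I_s) (k : 'I_t), [/\ j' = k :> nat,
    forall x, sigma' (real_idx t j') x = sigma (real_idx t j) x &
    forall x, `|sigma' (cplx_idx s k) x| = `|sigma (cplx_idx s a) x|].
Proof.
move=> st ls ls'.
have [_ all' re' _ cj'] := ls'; have [_ all _ nr _] := ls.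
have [i iE] := all' (sigma (cplx_idx s a)).
have [[j ij]|[k ik _]] := labelling_realP i ls'.
  by case: (nr a) => x; rewrite iE ij; exact: re'.
pose j' := cast_ord (esym st) k.
have [l lE] := all (sigma' (real_idx t j')).
have [[j lj]|[? _ []]] := labelling_realP l ls; last by move=> x; rewrite -lE; exact: re'.
exists j, j', k; split=> // x; first by rewrite lE lj.
by rewrite iE; case: ik => ->; rewrite // cj' norm_conjC.
Qed.

Theorem corollary3 (R : realType) (s t : nat) (K : fieldExtType rat)
    (sigma : 'I_(s + t + t) -> {rmorphism K -> Cx R}) (U : set K)
    (hs : (1 <= s)%N) (ht : (1 <= t)%N)
    (hsigma : embedding_labelling sigma) (hU : admissible sigma U) :
  admits_pluriclosed_metric (OT_manifold sigma U) <->
  s = t /\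
  exists sigma' : 'I_(s + t + t) -> {rmorphism K -> Cx R},
    embedding_labelling sigma' /\
    forall u, U u -> forall (j : 'I_s) (k : 'I_t), j = k :> nat ->
      sigma' (real_idx t j) u * `|sigma' (cplx_idx s k) u| ^+ 2 = 1.
Proof.
have [Usub Upos _ Upd Ucc] := hU; split.
  by move=> [h [hm hp]]; exact: (forward_condition hsigma hs Usub Upos Upd Ucc hm hp).
move=> [st [sigma' [hsigma' hcond]]].
have /choice[jj jjP] (a : 'I_t) : exists j, forall u, U u ->
  sre sigma j u * cnorm2 sigma a u = 1.
  have [j [j' [k [jk re ab]]]] := relabelling_index a st hsigma hsigma'.
  exists j => u Uu; have := hcond u Uu j' k jk.
  by rewrite re ab (sigma_real hsigma) cnorm2E -rmorphM /= => -[].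
exact: (std_admits hsigma hs Usub Upos jjP).
Qed.
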